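(* Let $(N^3(c),h)$ be a Lorentzian space form of constant sectional curvature $c$, and let $\phi:(M^2,\bar g)\to N^3(c)$ be a spacelike or timelike conformal immersion with $g=\phi^*h=\lambda^2\bar g$, $\lambda>0$. Let $\xi$ be a (local) unit normal field, $\varepsilon=h(\xi,\xi)$, let $A$ be the shape operator and $H$ the scalar mean curvature of $\phi:(M,g)\to N^3(c)$ with respect to $\xi$, and define $u:=\lambda^2H$. Then $\phi:(M^2,\bar g)\to N^3(c)$ is biharmonic if and only if $$\Delta_gu+\bigl(-\varepsilon|A|_g^2+2c\bigr)u=0$$ and $$A(\operatorname{grad}_gu)+\varepsilon u\operatorname{grad}_gH=0.$$
   Context: $N^3(c)$ has signature $(-,+,+)$ and curvature tensor $R^N(X,Y)Z=c\bigl(h(Y,Z)X-h(X,Z)Y\bigr)$. The immersion is spacelike if $g$ is Riemannian (then $\varepsilon=-1$) and timelike if $g$ is Lorentzian (then $\varepsilon=+1$). Conventions: $\nabla^N_X\xi=-AX$, $\nabla^N_XY=\nabla_XY+\varepsilon g(AX,Y)\xi$; $H$ is defined by $\mathbf H=H\xi$ with $\mathbf H$ half the $g$-trace of the second fundamental form, so $H=\frac\varepsilon2\operatorname{tr}_gA$. For a local $g$-pseudo-orthonormal frame, $g(e_i,e_j)=\epsilon_i\delta_{ij}$, $\epsilon_i=\pm1$: $\Delta_gf=\sum_i\epsilon_i(e_i(e_if)-(\nabla_{e_i}e_i)f)$ and $|A|_g^2:=\operatorname{tr}_g(A^2)=\sum_i\epsilon_ig(Ae_i,Ae_i)$. For a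 smooth map $\phi:(M,g')\to(N,h)$ between pseudo-Riemannian manifolds, $\tau_{g'}(\phi)=\operatorname{tr}_{g'}\nabla d\phi$ is the tension field and $\tau_{2,g'}(\phi)=\Delta^\phi_{g'}\tau_{g'}(\phi)-\sum_i\epsilon_iR^N(d\phi(e_i),\tau_{g'}(\phi))d\phi(e_i)$ is the bitension field, where $\{e_i\}$ is a local $g'$-pseudo-orthonormal frame and $\Delta^\phi_{g'}V=\sum_i\epsilon_i(\nabla^\phi_{e_i}\nabla^\phi_{e_i}V-\nabla^\phi_{\nabla_{e_i}e_i}V)$. The map is biharmonic (with respect to $g'$) if $\tau_{2,g'}(\phi)=0$. *)

(* Defs.v *)
From mathcomp Require Import all_boot all_order all_algebra.
From mathcomp Require Import all_classical all_reals.
From mathcomp Require Import topology normedtype derive.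

Set Implicit Arguments.
Unset Strict Implicit.
Unset Printing Implicit Defensive.
Import Order.TTheory GRing.Theory Num.Theory.
Import numFieldNormedType.Exports.

Local Open Scope classical_set_scope.
Local Open Scope ring_scope.

(* MathComp-Analysis has no manifolds.  A manifold is a topological space with
   an atlas, and a tensor (or a vector field along a map) is the family of its
   components in the charts of the atlas, subject to the usual transformation
   law.  Tangent vectors are ROW vectors of components, so a linear map with
   matrix B sends v to v *m B; in particular 'J f p has the i-th partial
   derivative of f as its i-th row. *)

Section CoordinateCalculus.
Context {R : realType}.

Definition pd n (V : normedModType R) (i : 'I_n) (f : 'rV[R]_n -> V) :
    'rV[R]_n -> V :=
  fun p => 'D_(delta_mx 0 i) f p.

Fixpoint diff_times n (V : normedModType R) (k : nat) (U : set 'rV[R]_n)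
    (f : 'rV[R]_n -> V) : Prop :=
  if k is k'.+1 then
    (forall p, U p -> differentiable f p) /\
    (forall i, diff_times k' U (pd i f))
  else True.

(* Only meant for open U: pd is a derivative in the whole space. *)
Definition smooth_on n (V : normedModType R) (U : set 'rV[R]_n)
    (f : 'rV[R]_n -> V) : Prop :=
  forall k, diff_times k U f.

Definition mform n (G : 'M[R]_n) (X Y : 'rV[R]_n) : R :=
  (X *m G *m Y^T) 0 0.

(* Trace with respect to G of the bilinear map with values T i j on the
   coordinate basis; [gtrace_frame] gives its expression in a
   pseudo-orthonormal basis. *)
Definition gtrace n (V : lmodType R) (G : 'M[R]_n) (T : 'I_n -> 'I_n -> V) : V :=
  \sum_i \sum_j invmx G i j *: T i j.

Lemma gtrace_frame n (V : lmodType R) (G E : 'M[R]_n) (s : 'rV[R]_n)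
    (T : 'I_n -> 'I_n -> V) :
  (forall i, s 0 i = 1 \/ s 0 i = -1) -> E *m G *m E^T = diag_mx s ->
  gtrace G T =
  \sum_i s 0 i *: (\sum_j \sum_k (E i j * E i k) *: T j k).
Proof.
move=> s1 EGE.
have ss : diag_mx s *m diag_mx s = 1%:M.
  rewrite mulmx_diag -diag_const_mx; congr diag_mx; apply/rowP => i.
  by rewrite !mxE; case: (s1 i) => ->; rewrite ?mulrNN mulr1.
have EGEs : E *m (G *m E^T *m diag_mx s) = 1%:M by rewrite !mulmxA EGE ss.
have invG : G *m (E^T *m diag_mx s *m E) = 1%:M.
  by have := mulmx1C EGEs; rewrite !mulmxA.
have Gu : G \in unitmx by have [] := mulmx1_unit invG.
have -> : gtrace G T =
    \sum_j \sum_k (E^T *m diag_mx s *m E) j k *: T j k.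
  suff -> : E^T *m diag_mx s *m E = invmx G by [].
  by rewrite -[RHS]mulmx1 -invG mulKmx.
under [RHS]eq_bigr => i _ do rewrite scaler_sumr.
rewrite [RHS]exchange_big /=; apply: eq_bigr => j _.
under [RHS]eq_bigr => i _ do rewrite scaler_sumr.
rewrite [RHS]exchange_big /=; apply: eq_bigr => k _.
rewrite mxE scaler_suml; apply: eq_bigr => i _.
by rewrite mul_mx_diag !mxE scalerA mulrA [s _ _ * _]mulrC.
Qed.

(* The coefficient of \partial_k in \nabla_{\partial_i} \partial_j, for the
   Levi-Civita connection of G. *)
Definition christoffel n (G : 'rV[R]_n -> 'M[R]_n) (p : 'rV[R]_n)
    (i j k : 'I_n) : R :=
  2^-1 * \sum_l invmx (G p) k l *
    (pd i G p j l + pd j G p i l - pd l G p i j).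

(* The coefficient of \partial_d in R(\partial_a, \partial_b) \partial_c, where
   R(X, Y) Z = \nabla_X \nabla_Y Z - \nabla_Y \nabla_X Z - \nabla_{[X, Y]} Z. *)
Definition riemann_coef n (G : 'rV[R]_n -> 'M[R]_n) (p : 'rV[R]_n)
    (a b c d : 'I_n) : R :=
  pd a (fun q => christoffel G q b c d) p
  - pd b (fun q => christoffel G q a c d) p
  + \sum_e (christoffel G p b c e * christoffel G p a e d
            - christoffel G p a c e * christoffel G p b e d).

Definition riemann n (G : 'rV[R]_n -> 'M[R]_n) (p X Y Z : 'rV[R]_n) :
    'rV[R]_n :=
  \row_d \sum_a \sum_b \sum_c
    X 0 a * Y 0 b * Z 0 c * riemann_coef G p a b c d.

Definition grad n (G : 'rV[R]_n -> 'M[R]_n) (u : 'rV[R]_n -> R)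
    (p : 'rV[R]_n) : 'rV[R]_n :=
  (\row_i pd i u p) *m invmx (G p).

Definition laplacian n (G : 'rV[R]_n -> 'M[R]_n) (u : 'rV[R]_n -> R)
    (p : 'rV[R]_n) : R :=
  \sum_i \sum_j invmx (G p) i j *
    (pd i (pd j u) p - \sum_l christoffel G p i j l * pd l u p).

Section Maps.
(* f is a map between coordinate domains carrying the metrics G and K. *)
Variables (m n : nat) (G : 'rV[R]_m -> 'M[R]_m) (K : 'rV[R]_n -> 'M[R]_n).
Variable f : 'rV[R]_m -> 'rV[R]_n.

(* \nabla^f_{\partial_i} V for a vector field V along f. *)
Definition cov (i : 'I_m) (V : 'rV[R]_m -> 'rV[R]_n) (p : 'rV[R]_m) :
    'rV[R]_n :=
  pd i V p
  + \row_k \sum_a \sum_b christoffel K (f p) a b k * pd i f p 0 a * V p 0 b.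

(* (\nabla df)(\partial_i, \partial_j); when f is an isometric immersion this
   is \nabla^N_X Y - \nabla_X Y, the second fundamental form. *)
Definition second_form (p : 'rV[R]_m) (i j : 'I_m) : 'rV[R]_n :=
  cov i (pd j f) p - \sum_l christoffel G p i j l *: pd l f p.

Definition tension (p : 'rV[R]_m) : 'rV[R]_n :=
  gtrace (G p) (second_form p).

Definition rough_laplacian (V : 'rV[R]_m -> 'rV[R]_n) (p : 'rV[R]_m) :
    'rV[R]_n :=
  gtrace (G p) (fun i j =>
    cov i (cov j V) p - \sum_l christoffel G p i j l *: cov l V p).

Definition bitension (p : 'rV[R]_m) : 'rV[R]_n :=
  rough_laplacian tension p
  - gtrace (G p) (fun i j =>
      riemann K (f p) (pd i f p) (tension p) (pd j f p)).

End Maps.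
End CoordinateCalculus.

(* The type [chart] indexes the atlas; [cinv x] is only meaningful on the
   image of [cdom x]. *)
Record manifold (R : realType) (n : nat) := Manifold {
  carrier :> topologicalType;
  chart : Type;
  cdom : chart -> set carrier;
  cmap : chart -> carrier -> 'rV[R]_n;
  cinv : chart -> 'rV[R]_n -> carrier;
  cdom_open : forall x, open (cdom x);
  cimage_open : forall x, open (cmap x @` cdom x);
  cmapK : forall x p, cdom x p -> cinv x (cmap x p) = p;
  cmap_continuous : forall x p, cdom x p -> {for p, continuous (cmap x)};
  cinv_continuous : forall x p, cdom x p ->
    {for cmap x p, continuous (cinv x)};
  cdom_cover : forall p, exists x, cdom x p;
  transition_smooth : forall x y,
    smooth_on (cmap x @` (cdom x `&` cdom y)) (cmap y \o cinv x);
  manifold_hausdorff : hausdorff_space carrier;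
  manifold_second_countable : @second_countable carrier
}.

Section Geometry.
Context {R : realType}.

Definition transition n (M : manifold R n) (x y : chart M) (p : M) :
    'M[R]_n :=
  'J (cmap y \o cinv x) (cmap x p).

Record metric n (M : manifold R n) := Metric {
  mcoef :> chart M -> M -> 'M[R]_n;
  mcoef_sym : forall x p, cdom x p -> (mcoef x p)^T = mcoef x p;
  mcoef_nondegenerate : forall x p, cdom x p -> mcoef x p \in unitmx;
  mcoef_smooth : forall x, smooth_on (cmap x @` cdom x) (mcoef x \o cinv x);
  mcoef_transition : forall x y p, cdom x p -> cdom y p ->
    mcoef x p = transition x y p *m mcoef y p *m (transition x y p)^T
}.

Definition has_signature n (M : manifold R n) (g : metric M) (s : 'rV[R]_n) :=
  forall x p, cdom x p ->
    exists E : 'M[R]_n, E *m g x p *m E^T = diag_mx s.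

Definition riemannian n (M : manifold R n) (g : metric M) :=
  has_signature g (const_mx 1).

(* Signature (-, +, ..., +). *)
Definition lorentzian n (M : manifold R n) (g : metric M) :=
  has_signature g (\row_i (-1) ^+ (i == 0%N :> nat)).

Definition metric_in n (M : manifold R n) (g : metric M) (x : chart M) :
    'rV[R]_n -> 'M[R]_n :=
  g x \o cinv x.

Definition constant_curvature n (M : manifold R n) (g : metric M) (c : R) :=
  forall x p (X Y Z : 'rV[R]_n), cdom x p ->
    riemann (metric_in g x) (cmap x p) X Y Z =
    c *: (mform (g x p) Y Z *: X - mform (g x p) X Z *: Y).

Definition smooth_function n (M : manifold R n) (u : M -> R) :=
  forall x, smooth_on (cmap x @` cdom x) (u \o cinv x).

Section MapsOfManifolds.
Variables (m n : nat) (M : manifold R m) (N : manifold R n) (phi : M -> N).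

Definition map_in (x : chart M) (y : chart N) : 'rV[R]_m -> 'rV[R]_n :=
  cmap y \o phi \o cinv x.

Definition dmap (x : chart M) (y : chart N) (p : M) : 'M[R]_(m, n) :=
  'J (map_in x y) (cmap x p).

Definition smooth_map :=
  continuous phi /\
  forall x y,
    smooth_on (cmap x @` (cdom x `&` phi @^-1` cdom y)) (map_in x y).

Definition immersion :=
  smooth_map /\
  forall x y p, cdom x p -> cdom y (phi p) -> row_free (dmap x y p).

Definition is_pullback (h : metric N) (g : metric M) :=
  forall x y p, cdom x p -> cdom y (phi p) ->
    g x p = dmap x y p *m h y (phi p) *m (dmap x y p)^T.

Definition biharmonic_on (W : set M) (g : metric M) (h : metric N) :=
  forall x y p, W p -> cdom x p -> cdom y (phi p) ->
    bitension (metric_in g x) (metric_in h y) (map_in x y) (cmap x p) = 0.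

(* A vector field along phi on W has components xi y in each chart y of N. *)
Definition vector_field_along (W : set M) (xi : chart N -> M -> 'rV[R]_n) :=
  (forall x y, smooth_on (cmap x @` (W `&` cdom x `&` phi @^-1` cdom y))
                         (xi y \o cinv x)) /\
  (forall y y' p, W p -> cdom y (phi p) -> cdom y' (phi p) ->
     xi y' p = xi y p *m transition y y' (phi p)).

Definition unit_normal (W : set M) (h : metric N)
    (xi : chart N -> M -> 'rV[R]_n) (eps : R) :=
  [/\ vector_field_along W xi,
      eps = 1 \/ eps = -1,
      forall x y p (X : 'rV[R]_m), W p -> cdom x p -> cdom y (phi p) ->
        mform (h y (phi p)) (xi y p) (X *m dmap x y p) = 0
    & forall y p, W p -> cdom y (phi p) ->
        mform (h y (phi p)) (xi y p) (xi y p) = eps].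

(* \nabla^N_X xi = - A X; since phi is an immersion this determines A x p. *)
Definition shape_operator (W : set M) (h : metric N)
    (xi : chart N -> M -> 'rV[R]_n) (A : chart M -> M -> 'M[R]_m) :=
  forall x y p i, W p -> cdom x p -> cdom y (phi p) ->
    cov (metric_in h y) (map_in x y) i (xi y \o cinv x) (cmap x p) =
    - (row i (A x p) *m dmap x y p).

End MapsOfManifolds.

Section Surfaces.
Variables (n : nat) (M : manifold R 2) (N : manifold R n) (phi : M -> N).

(* The mean curvature vector, half the g-trace of the second fundamental form,
   is H xi. *)
Definition mean_curvature (W : set M) (g : metric M) (h : metric N)
    (xi : chart N -> M -> 'rV[R]_n) (H : M -> R) :=
  forall x y p, W p -> cdom x p -> cdom y (phi p) ->
    2^-1 *: gtrace (g x p) (second_form (metric_in g x) (metric_in h y)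
                              (map_in phi x y) (cmap x p)) =
    H p *: xi y p.

(* g = phi^* h = lambda^2 gbar. *)
Definition conformal_immersion (gbar : metric M) (h : metric N)
    (lambda : M -> R) (g : metric M) :=
  [/\ immersion phi,
      smooth_function lambda,
      forall p, 0 < lambda p,
      is_pullback phi h g
    & forall x p, cdom x p -> g x p = lambda p ^+ 2 *: gbar x p].

End Surfaces.
End Geometry.

(* Main.v *)
Require Import Defs.
From mathcomp Require Import all_boot all_order all_algebra.
From mathcomp Require Import all_classical all_reals.
From mathcomp Require Import topology normedtype derive.
From mathcomp Require Import landau ring.
Import Order.TTheory GRing.Theory Num.Theory.
Import numFieldNormedType.Exports.
Set Implicit Arguments.
Unset Strict Implicit.
Unset Printing Implicit Defensive.
Local Open Scope classical_set_scope.
Local Open Scope ring_scope.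

(** Both sides of the equivalence are pointwise statements in a chart [x] of
    the surface and a chart [y] of the ambient space, so everything reduces to
    an identity between smooth functions on open subsets of coordinate spaces.

    In dimension two a conformal change of metric multiplies the trace of any
    Hessian by the conformal factor, because the trace of the Christoffel
    symbols changes by a multiple of [2 - dim] ([gtrace_hessian_conformal]).
    Hence, with [g = lambda^2 gbar], the tension field of [phi] for [gbar] is
    [lambda^2] times the one for [g], that is [2 u xi]; the same covariance of
    the rough Laplacian and constant curvature of the target then give
    ([bitension_conformal])
      [tau_2 = 2 lambda^2 (Delta^phi (u xi) + 2 c u xi)],
    where [Delta^phi] is the rough Laplacian for [g].

    It remains to split [Delta^phi (u xi)] into normal and tangent parts.  By
    the Leibniz rule it is
      [(Delta u) xi + 2 nabla_(grad u) xi + u Delta^phi xi],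
    and [nabla_(grad u) xi = - A (grad u)] by the definition of the shape
    operator.  Differentiating [h (nabla_X xi, xi) = 0] shows that the normal
    component of [Delta^phi xi] is [- eps |A|^2] ([rough_laplacian_normal]).
    Its tangent component is minus the divergence of [A], which is minus the
    gradient of [tr A = 2 eps H]: the Ricci identity in a space of constant
    curvature makes the second covariant derivative of [xi] symmetric
    ([second_covC]), which is Codazzi's equation, and so the derivative of
    [A] is symmetric in all its arguments ([rough_laplacian_tangent]).  The
    normal part of the bracket is then
      [(Delta u + (- eps |A|^2 + 2 c) u) xi]
    and its tangent part is
      [- 2 (A (grad u) + eps u grad H)].
    The bracket vanishes when both do, since [xi] and the coordinate tangent
    vectors form a basis ([normal_frame_separates]).

    The covariant derivative along a map is handled as a matrix: in components
    it is [V |-> pd i V + V *m conn_mx i], and the properties of the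
    Levi-Civita connection needed above (metric, torsion free, Ricci identity)
    become identities between matrices of functions.  The analysis beneath is
    the equality of mixed partial derivatives ([deriveC]) and the stability of
    smoothness under the operations used. *)

(** * Equality of mixed derivatives *)

Section MixedDerivatives.
Context {R : realType} {V : normedModType R}.
Implicit Types (f : V -> R) (p q v w : V) (h : R).

(** Directional derivatives only see the restriction to a line. *)
Lemma is_derive_line (V' : normedModType R) f p v (g : V' -> R) (q w : V') :
  (forall h : R, f (h *: v + p) = g (h *: w + q)) ->
  derivable f p v -> is_derive q w g ('D_v f p).
Proof.
move=> fg fp; have fg0 : f p = g q.
  by have := fg 0; rewrite !scale0r !add0r.
have E : (fun h : R => h^-1 *: ((f \o shift p) (h *: v) - f p))
  = (fun h : R => h^-1 *: ((g \o shift q) (h *: w) - g q)).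
  by apply/funext => h /=; rewrite fg fg0.
by split; rewrite /derivable /derive -E.
Qed.

Lemma mvt_along f q v h : 0 < h ->
  (forall t : R, 0 <= t <= h -> differentiable f (t *: v + q)) ->
  exists2 t : R, 0 <= t <= h & f (h *: v + q) - f q = h * 'D_v f (t *: v + q).
Proof.
move=> h0 df.
pose F (t : R) := f (t *: v + q).
have dF (t : R) : 0 <= t <= h -> is_derive t 1 F ('D_v f (t *: v + q)).
  move=> th; have dft := @diff_derivable _ _ _ _ _ v (df t th).
  apply: is_derive_line dft => s.
  by rewrite /F [s *: 1]mulr1 scalerDl addrA.
have cF : {within `[0, h], continuous F}.
  apply: derivable_within_continuous => t /=; rewrite in_itv /= => th.
  exact: (@ex_derive _ _ _ _ _ _ _ (dF t th)).
have dF' (t : R) : t \in `]0, h[ -> is_derive t 1 F ('D_v f (t *: v + q)).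
  by move=> /subset_itv_oo_cc; rewrite in_itv; exact: dF.
have [t th FE] := MVT h0 dF' cF.
exists t; first by move/subset_itv_oo_cc: th; rewrite in_itv.
by move: FE; rewrite /F scale0r add0r subr0 mulrC.
Qed.

(** The second difference over a parallelogram is a value of the iterated
    derivative: apply the mean value theorem first to the difference of two
    translates of [f], then to ['D_v f]. *)
Lemma second_difference f p v w h : 0 < h ->
  (forall s t : R, 0 <= s <= h -> 0 <= t <= h ->
     differentiable f (t *: w + (s *: v + p)) /\
     differentiable ('D_v f) (t *: w + (s *: v + p))) ->
  exists s t : R, [/\ 0 <= s <= h, 0 <= t <= h &
    f (h *: w + (h *: v + p)) - f (h *: v + p) - (f (h *: w + p) - f p)
    = h * (h * 'D_w ('D_v f) (t *: w + (s *: v + p)))].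
Proof.
move=> h0 df.
have h0h : 0 <= h <= h by rewrite ltW /=.
have z0h : 0 <= (0 : R) <= h by rewrite lexx ltW.
pose g q := f (h *: w + q) - f q.
have dtr s : 0 <= s <= h -> differentiable (fun q => f (h *: w + q)) (s *: v + p).
  move=> sh; apply: (@differentiable_comp _ _ _ _ (fun q => h *: w + q) f).
    exact: differentiableD.
  by have [] := df s h sh h0h.
have df0 s : 0 <= s <= h -> differentiable f (s *: v + p).
  by move=> sh; have [] := df s 0 sh z0h; rewrite scale0r add0r.
have [s sh gE] : exists2 s : R, 0 <= s <= h &
    g (h *: v + p) - g p = h * 'D_v g (s *: v + p).
  apply: mvt_along => // s sh.
  by apply: differentiableB; [exact: dtr|exact: df0].
have DgE : 'D_v g (s *: v + p) =
    'D_v f (h *: w + (s *: v + p)) - 'D_v f (s *: v + p).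
  rewrite /g deriveB; [|exact/diff_derivable/dtr|exact/diff_derivable/df0].
  congr (_ - _); apply: (@derive_val _ _ _ _ _ (fun q => f (h *: w + q))).
  apply: is_derive_line; last first.
    apply/diff_derivable; have [] := df s h sh h0h; first exact.
  by move=> t; rewrite addrCA.
have [t th fE] := mvt_along h0 (fun t th => (df s t sh th).2).
by exists s, t; split => //; rewrite -fE -DgE -gE.
Qed.

(** Schwarz's theorem: the second difference is symmetric in [v] and [w], so on
    arbitrarily small parallelograms the two iterated derivatives have a common
    value, and continuity carries this equality to [p]. *)
Lemma deriveC f (U : set V) p v w : open U -> U p ->
  (forall q, U q -> differentiable f q) ->
  (forall q, U q -> differentiable ('D_v f) q) ->
  (forall q, U q -> differentiable ('D_w f) q) ->
  {for p, continuous ('D_w ('D_v f))} ->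
  {for p, continuous ('D_v ('D_w f))} ->
  'D_w ('D_v f) p = 'D_v ('D_w f) p.
Proof.
move=> oU Up df dv dw cvw cvv.
apply/eqP; rewrite -subr_eq0 -normr_le0; apply/ler_addgt0Pr => e e0.
rewrite add0r.
have e20 : 0 < e / 2 by rewrite divr_gt0.
have nU : \forall q \near p, U q by exact: open_nbhs_nbhs.
have nwv : \forall q \near p, `|'D_w ('D_v f) p - 'D_w ('D_v f) q| < e / 2.
  exact: ((cvgrPdist_lt _ _).1 cvw).
have nvw : \forall q \near p, `|'D_v ('D_w f) p - 'D_v ('D_w f) q| < e / 2.
  exact: ((cvgrPdist_lt _ _).1 cvv).
have [r /= r0 Br] := (nbhs_normP _ _).1 (filterI nU (filterI nwv nvw)).
(* A side so small that the parallelogram stays in the ball of radius [r];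
   the summand 1 covers the case where [v] and [w] are both zero. *)
pose h := r / (`|v| + `|w| + 1).
have d0 : 0 < `|v| + `|w| + 1 by rewrite ltr_wpDl ?addr_ge0.
have h0 : 0 < h by rewrite divr_gt0.
have Bh (s t : R) : 0 <= s <= h -> 0 <= t <= h ->
    `|p - (t *: w + (s *: v + p))| < r.
  move=> /andP[s0 sh] /andP[t0 th] /=.
  rewrite addrA [_ + p]addrC opprD addNKr normrN.
  apply: (@le_lt_trans _ _ (h * (`|v| + `|w|))).
    rewrite (le_trans (ler_normD _ _))// !normrZ !ger0_norm// mulrDr addrC.
    by rewrite lerD// ler_wpM2r.
  by rewrite mulrAC ltr_pdivrMr// ltr_pM2l// ltrDl.
have [s [t [sh th E1]]] : exists s t : R, [/\ 0 <= s <= h, 0 <= t <= h &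
    f (h *: w + (h *: v + p)) - f (h *: v + p) - (f (h *: w + p) - f p)
    = h * (h * 'D_w ('D_v f) (t *: w + (s *: v + p)))].
  apply: second_difference => // s t sh th.
  by have [Uq _] := Br _ (Bh s t sh th); split; [exact: df|exact: dv].
have [s' [t' [sh' th' E2]]] : exists s t : R, [/\ 0 <= s <= h, 0 <= t <= h &
    f (h *: v + (h *: w + p)) - f (h *: w + p) - (f (h *: v + p) - f p)
    = h * (h * 'D_v ('D_w f) (t *: v + (s *: w + p)))].
  apply: second_difference => // s' t' sh' th'.
  have [Uq _] := Br _ (Bh t' s' th' sh').
  by split; [apply: df|apply: dw]; rewrite addrCA.
have EE : 'D_w ('D_v f) (t *: w + (s *: v + p)) =
          'D_v ('D_w f) (t' *: v + (s' *: w + p)).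
  apply: (mulfI (lt0r_neq0 h0)); apply: (mulfI (lt0r_neq0 h0)).
  apply: etrans (esym E1) _; apply: etrans E2.
  rewrite [h *: v + (h *: w + p)]addrCA; ring.
have [_ [/= L1 _]] := Br _ (Bh s t sh th).
have [_ [_ /=]] := Br _ (Bh t' s' th' sh'); rewrite addrCA -EE => L2.
set a := 'D_w _ p in L1 *; set b := 'D_v _ p in L2 *.
set z := 'D_w _ _ in L1 L2.
clearbody a b z.
rewrite (_ : a - b = (a - z) - (b - z)); last by ring.
apply: le_trans (ler_normB _ _) _.
by rewrite [e in _ <= e]splitr; apply: lerD; exact: ltW.
Qed.
End MixedDerivatives.
(** * Smooth functions on open sets *)

Section Germs.
Context {R : realType}.

(** [f] and [g] differ by a function that vanishes near [p], and such a
    function is its own remainder term. *)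
Lemma differentiable_near (V W : normedModType R) (f g : V -> W) (p : V) :
  (\forall q \near p, f q = g q) -> differentiable f p -> differentiable g p.
Proof.
move=> fg df; pose e q := g q - f q.
have e0 : e \o shift p = cst (e p) + \0 +o_ 0 id.
  apply/eqaddoP => r r0.
  have nfg : \forall h \near (0 : V), f (h + p) = g (h + p).
    by move: fg; rewrite (near_shift 0 p) subr0.
  apply: filterS nfg => h fgh.
  rewrite !fctE /= /e fgh (nbhs_singleton fg) !subrr !addr0 oppr0.
  have -> : (0 + 0 : W) = 0 by rewrite addr0.
  by rewrite normr0 mulr_ge0 // ltW.
have de : differentiable e p.
  apply/diff_locallyP.
  have c0 : continuous (\0 : V -> W) by exact: cst_continuous.
  by rewrite (diff_unique c0 e0).
have -> : g = f + e by apply/funext => q; rewrite fctE /e addrC subrK.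
exact: differentiableD.
Qed.

End Germs.

Section Calculus.
Context {R : realType} {n : nat}.
Implicit Types (p q : 'rV[R]_n) (U : set 'rV[R]_n).

Lemma pd_near (V : normedModType R) (U : set 'rV[R]_n) (f g : 'rV[R]_n -> V) i p :
  open U -> U p -> {in U, f =1 g} -> pd i f p = pd i g p.
Proof.
move=> oU Up fg; apply: near_eq_derive.
have nU : \forall q \near p, U q by exact: open_nbhs_nbhs.
by apply: filterS nU => q Uq; apply: fg; rewrite inE.
Qed.

Lemma differentiable_mx a b (f : 'rV[R]_n -> 'M[R]_(a, b)) p :
  differentiable f p <-> forall i j, differentiable (fun q => f q i j) p.
Proof.
split=> [df i j|df].
  exact: (differentiable_comp df (differentiable_coord (f p) i j)).
have -> : f = \sum_i \sum_j (fun q => f q i j *: delta_mx i j).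
  apply/funext => q; rewrite fct_sumE [LHS]matrix_sum_delta.
  by apply: eq_bigr => i _; rewrite fct_sumE.
apply: differentiable_sum => i; apply: differentiable_sum => j.
exact: differentiableZl.
Qed.

Lemma pd_mxE a b (f : 'rV[R]_n -> 'M[R]_(a, b)) p i k l :
  differentiable f p -> pd i f p k l = pd i (fun q => f q k l) p.
Proof. by move=> df; rewrite /pd derive_mx ?mxE//; exact: diff_derivable. Qed.

Lemma pdD (V : normedModType R) (f g : 'rV[R]_n -> V) i p :
  differentiable f p -> differentiable g p ->
  pd i (fun q => f q + g q) p = pd i f p + pd i g p.
Proof. by move=> df dg; rewrite /pd deriveD//; exact: diff_derivable. Qed.

Lemma pdN (V : normedModType R) (f : 'rV[R]_n -> V) i p :
  differentiable f p -> pd i (fun q => - f q) p = - pd i f p.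
Proof. by move=> df; rewrite /pd deriveN//; exact: diff_derivable. Qed.

Lemma pd_sum (V : normedModType R) m (f : 'I_m -> 'rV[R]_n -> V) i p :
  (forall j, differentiable (f j) p) ->
  pd i (fun q => \sum_j f j q) p = \sum_j pd i (f j) p.
Proof.
move=> df; rewrite /pd -derive_sum => [|j]; last exact: diff_derivable.
by congr derive; apply/funext => q; rewrite fct_sumE.
Qed.

Lemma pd_cst (V : normedModType R) (c : V) i p : pd i (fun=> c) p = 0.
Proof. exact: derive_cst. Qed.

Lemma pdM (f g : 'rV[R]_n -> R) i p :
  differentiable f p -> differentiable g p ->
  pd i (fun q => f q * g q) p = f p * pd i g p + g p * pd i f p.
Proof.
by move=> df dg; rewrite /pd deriveM//; exact: diff_derivable.
Qed.

Lemma pdC (f : 'rV[R]_n -> R) (U : set 'rV[R]_n) i j p : open U -> U p ->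
  smooth_on U f -> pd i (pd j f) p = pd j (pd i f) p.
Proof.
move=> oU Up sf.
have d1 q : U q -> differentiable f q by have [+ _] := sf 1%N; exact.
have d2 k q : U q -> differentiable (pd k f) q.
  by have [_ /(_ k)[+ _]] := sf 2%N; exact.
have d3 k l q : U q -> differentiable (pd l (pd k f)) q.
  by have [_ /(_ k)[_ /(_ l)[+ _]]] := sf 3; exact.
apply: (deriveC oU Up) => // [q|q||]; first exact: d2.
- exact: d2.
- exact/differentiable_continuous/d3.
- exact/differentiable_continuous/d3.
Qed.
End Calculus.
Section SmoothFunctions.
Context {R : realType} {n : nat}.
Variable U : set 'rV[R]_n.
Hypothesis oU : open U.

(** The values of [pd i f] on the open set [U] are determined by those of [f],
    which is what lets the closure properties below be proved by induction on
    the order of differentiability: the formula for a first derivative only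
    holds on [U]. *)
Lemma diff_times_eq (V : normedModType R) k (f g : 'rV[R]_n -> V) :
  {in U, f =1 g} -> diff_times k U f -> diff_times k U g.
Proof.
elim: k f g => [//|k IH] f g fg [df dtf]; split=> [p Up|i].
  have nU : \forall q \near p, U q by exact: open_nbhs_nbhs.
  apply: differentiable_near (df p Up).
  by apply: filterS nU => q Uq; apply: fg; rewrite inE.
apply: IH (dtf i) => p; rewrite inE => Up.
exact: (pd_near _ oU).
Qed.

Lemma smooth_eq (V : normedModType R) (f g : 'rV[R]_n -> V) :
  {in U, f =1 g} -> smooth_on U f -> smooth_on U g.
Proof. by move=> fg sf k; exact: diff_times_eq fg (sf k). Qed.

Lemma diff_timesW (V : normedModType R) k (f : 'rV[R]_n -> V) :
  diff_times k.+1 U f -> diff_times k U f.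
Proof.
elim: k f => [//|k IH] f [df dtf]; split => // i.
exact: IH.
Qed.

Lemma smooth_differentiable (V : normedModType R) (f : 'rV[R]_n -> V) p :
  smooth_on U f -> U p -> differentiable f p.
Proof. by move=> /(_ 1%N)[+ _]; exact. Qed.

Lemma smooth_pd (V : normedModType R) (f : 'rV[R]_n -> V) i :
  smooth_on U f -> smooth_on U (pd i f).
Proof. by move=> sf k; have [_ +] := sf k.+1; exact. Qed.

Lemma smooth_cst (V : normedModType R) (c : V) : smooth_on U (fun=> c).
Proof.
move=> k; elim: k c => [//|k IH] c; split=> [p _|i].
  exact: differentiable_cst.
by apply: diff_times_eq (IH 0) => p _; apply/esym/pd_cst.
Qed.

Lemma diff_timesD (V : normedModType R) k (f g : 'rV[R]_n -> V) :
  diff_times k U f -> diff_times k U g ->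
  diff_times k U (fun p => f p + g p).
Proof.
elim: k f g => [//|k IH] f g [df dtf] [dg dtg]; split=> [p Up|i].
  by apply: differentiableD; [exact: df|exact: dg].
apply: diff_times_eq (IH _ _ (dtf i) (dtg i)) => p; rewrite inE => Up.
by rewrite pdD; [|exact: df|exact: dg].
Qed.

(** Stated for each finite order, since the induction uses the product rule at
    order [k] to differentiate a product [k.+1] times. *)
Lemma diff_timesM k (f g : 'rV[R]_n -> R) :
  diff_times k U f -> diff_times k U g ->
  diff_times k U (fun p => f p * g p).
Proof.
elim: k f g => [//|k IH] f g dtf dtg.
have [df dtf'] := dtf; have [dg dtg'] := dtg; split=> [p Up|i].
  by apply: differentiableM; [exact: df|exact: dg].
apply: diff_times_eq (diff_timesD (IH _ _ (diff_timesW dtf) (dtg' i))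
                                 (IH _ _ (diff_timesW dtg) (dtf' i))) => p.
by rewrite inE => Up; rewrite pdM; [|exact: df|exact: dg].
Qed.

Lemma smoothD (V : normedModType R) (f g : 'rV[R]_n -> V) :
  smooth_on U f -> smooth_on U g -> smooth_on U (fun p => f p + g p).
Proof. by move=> sf sg k; exact: diff_timesD. Qed.

Lemma smoothM (f g : 'rV[R]_n -> R) :
  smooth_on U f -> smooth_on U g -> smooth_on U (fun p => f p * g p).
Proof. by move=> sf sg k; exact: diff_timesM. Qed.

Lemma smoothV (f : 'rV[R]_n -> R) : (forall p, U p -> f p != 0) ->
  smooth_on U f -> smooth_on U (fun p => (f p)^-1).
Proof.
move=> f0 sf; elim=> [//|k IH]; split=> [p Up|i].
  exact: differentiableV (smooth_differentiable sf Up) (f0 p Up).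
have dV : diff_times k U (fun p => -1 * (((f p)^-1 * (f p)^-1) * pd i f p)).
  apply: diff_timesM; first exact: smooth_cst.
  by apply: diff_timesM; [exact: diff_timesM|exact: smooth_pd].
apply: diff_times_eq dV => p; rewrite inE => Up.
rewrite {2}/pd deriveV ?f0//; last exact/diff_derivable/smooth_differentiable.
by rewrite mulN1r scaleNr -exprVn expr2.
Qed.

Lemma diff_times_sum (V : normedModType R) (I : Type) (r : seq I) (P : pred I)
    k (f : I -> 'rV[R]_n -> V) : (forall i, diff_times k U (f i)) ->
  diff_times k U (fun p => \sum_(i <- r | P i) f i p).
Proof.
move=> sf; elim: r => [|i r IH].
  by apply: diff_times_eq (smooth_cst 0 k) => p _; rewrite big_nil.
have [Pi|nPi] := boolP (P i).
  by apply: diff_times_eq (diff_timesD (sf i) IH) => p _; rewrite big_cons Pi.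
by apply: diff_times_eq IH => p _; rewrite big_cons (negPf nPi).
Qed.

Lemma smooth_sum (V : normedModType R) (I : Type) (r : seq I) (P : pred I)
    (f : I -> 'rV[R]_n -> V) : (forall i, smooth_on U (f i)) ->
  smooth_on U (fun p => \sum_(i <- r | P i) f i p).
Proof. by move=> sf k; apply: diff_times_sum => i; exact: sf. Qed.

Lemma smooth_prod (I : Type) (r : seq I) (P : pred I)
    (f : I -> 'rV[R]_n -> R) : (forall i, smooth_on U (f i)) ->
  smooth_on U (fun p => \prod_(i <- r | P i) f i p).
Proof.
move=> sf; elim: r => [|i r IH].
  by apply: smooth_eq (smooth_cst (1 : R)) => p _; rewrite big_nil.
have [Pi|nPi] := boolP (P i).
  by apply: smooth_eq (smoothM (sf i) IH) => p _; rewrite big_cons Pi.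
by apply: smooth_eq IH => p _; rewrite big_cons (negPf nPi).
Qed.

Lemma diff_times_mx a b k (f : 'rV[R]_n -> 'M[R]_(a, b)) :
  diff_times k U f <-> forall i j, diff_times k U (fun p => f p i j).
Proof.
elim: k f => [//|k IH] f; split=> [[df dtf] i j|dtf].
  split=> [p Up|l]; first by have /differentiable_mx := df p Up; exact.
  have := (IH _).1 (dtf l) i j; apply: diff_times_eq => p; rewrite inE => Up.
  by rewrite pd_mxE//; exact: df.
have df p : U p -> differentiable f p.
  by move=> Up; apply/differentiable_mx => i j; have [+ _] := dtf i j; exact.
split=> [//|l]; apply/IH => i j.
have [_ /(_ l)] := dtf i j; apply: diff_times_eq => p; rewrite inE => Up.
by rewrite pd_mxE//; exact: df.
Qed.

Lemma smooth_mx a b (f : 'rV[R]_n -> 'M[R]_(a, b)) :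
  smooth_on U f <-> forall i j, smooth_on U (fun p => f p i j).
Proof.
split=> [sf i j k|sf k]; first exact: (diff_times_mx k f).1.
by apply/diff_times_mx => i j; exact: sf.
Qed.

Lemma smooth_mulmx a b c (f : 'rV[R]_n -> 'M[R]_(a, b))
    (g : 'rV[R]_n -> 'M[R]_(b, c)) :
  smooth_on U f -> smooth_on U g -> smooth_on U (fun p => f p *m g p).
Proof.
move=> /smooth_mx sf /smooth_mx sg; apply/smooth_mx => i j.
have s : smooth_on U (fun p => \sum_k f p i k * g p k j).
  by apply: smooth_sum => k; exact: smoothM.
by apply: smooth_eq s => p _; rewrite mxE.
Qed.

Lemma smooth_trmx a b (f : 'rV[R]_n -> 'M[R]_(a, b)) :
  smooth_on U f -> smooth_on U (fun p => (f p)^T).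
Proof.
move=> /smooth_mx sf; apply/smooth_mx => i j.
by apply: smooth_eq (sf j i) => p _; rewrite mxE.
Qed.

Lemma smoothZ a b (f : 'rV[R]_n -> R) (g : 'rV[R]_n -> 'M[R]_(a, b)) :
  smooth_on U f -> smooth_on U g -> smooth_on U (fun p => f p *: g p).
Proof.
move=> sf /smooth_mx sg; apply/smooth_mx => i j.
by apply: smooth_eq (smoothM sf (sg i j)) => p _; rewrite mxE.
Qed.

Lemma smoothN a b (f : 'rV[R]_n -> 'M[R]_(a, b)) :
  smooth_on U f -> smooth_on U (fun p => - f p).
Proof.
move=> sf; apply: smooth_eq (smoothZ (smooth_cst (-1 : R)) sf) => p _.
by rewrite scaleN1r.
Qed.

Lemma smooth_det a (f : 'rV[R]_n -> 'M[R]_a) :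
  (forall i j, smooth_on U (fun p => f p i j)) ->
  smooth_on U (fun p => \det (f p)).
Proof.
move=> sf; apply: smooth_sum => s; apply: smoothM; first exact: smooth_cst.
by apply: smooth_prod => i; exact: sf.
Qed.

(** Cramer's rule reduces inversion of matrices to that of the determinant. *)
Lemma smooth_invmx a (f : 'rV[R]_n -> 'M[R]_a) :
  (forall p, U p -> f p \in unitmx) -> smooth_on U f ->
  smooth_on U (fun p => invmx (f p)).
Proof.
move=> fu /smooth_mx sf.
have s : smooth_on U (fun p => (\det (f p))^-1 *: \adj (f p)).
  apply: smoothZ.
    apply: smoothV; last exact: smooth_det.
    by move=> p Up; have := fu p Up; rewrite unitmxE unitfE.
  apply/smooth_mx => i j.
  have sc : smooth_on U (fun p => cofactor (f p) j i).
    apply: smoothM; first exact: smooth_cst.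
    apply: smooth_det => k l.
    by apply: smooth_eq (sf (lift j k) (lift i l)) => p _; rewrite !mxE.
  by apply: smooth_eq sc => p _; rewrite mxE.
by apply: smooth_eq s => p; rewrite inE => Up; rewrite /invmx fu.
Qed.

End SmoothFunctions.

Section ChainRule.
Context {R : realType} {m n : nat}.

Lemma pd_comp (V : normedModType R) (f : 'rV[R]_m -> 'rV[R]_n)
    (g : 'rV[R]_n -> V) i p :
  differentiable f p -> differentiable g (f p) ->
  pd i (g \o f) p = \sum_a pd i f p 0 a *: pd a g (f p).
Proof.
move=> df dg; rewrite /pd deriveE; last exact: differentiable_comp.
rewrite diff_comp //= -(deriveE _ df); move: ('D__ f p) => v.
rewrite {1}[v]row_sum_delta linear_sum; apply: eq_bigr => a _.
by rewrite linearZ /= deriveE.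
Qed.

Variables (U : set 'rV[R]_m) (V : set 'rV[R]_n).
Hypothesis oU : open U.

Lemma smooth_comp a b (f : 'rV[R]_m -> 'rV[R]_n) (g : 'rV[R]_n -> 'M[R]_(a, b)) :
  (forall p, U p -> V (f p)) ->
  smooth_on U f -> smooth_on V g -> smooth_on U (g \o f).
Proof.
move=> UV sf sg k; elim: k g sg => [//|k IH] g sg; split=> [p Up|i].
  apply: differentiable_comp; first exact: smooth_differentiable sf Up.
  exact: smooth_differentiable sg (UV _ Up).
have s : diff_times k U
    (fun p => \sum_a pd i f p 0 a *: (pd a g \o f) p).
  apply: diff_times_sum => // e; apply/(diff_times_mx oU) => c d.
  have sg' := (diff_times_mx oU k _).1 (IH _ (smooth_pd e sg)) c d.
  have sf' := (smooth_mx oU _).1 (smooth_pd i sf) 0 e k.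
  apply: (diff_times_eq oU) (diff_timesM oU sf' sg') => p _.
  by rewrite mxE.
apply: (diff_times_eq oU) s => p; rewrite inE => Up.
rewrite [RHS]pd_comp//; first exact: smooth_differentiable sf Up.
exact: smooth_differentiable sg (UV _ Up).
Qed.

End ChainRule.
(** * Christoffel symbols as matrices *)

Section MatrixProductRule.
Context {R : realType} {n : nat}.
Implicit Types (p : 'rV[R]_n) (i : 'I_n).

Lemma differentiable_mulmx a b c (f : 'rV[R]_n -> 'M[R]_(a, b))
    (g : 'rV[R]_n -> 'M[R]_(b, c)) p : differentiable f p ->
  differentiable g p -> differentiable (fun q => f q *m g q) p.
Proof.
move=> /differentiable_mx df /differentiable_mx dg.
apply/differentiable_mx => i j.
have -> : (fun q => (f q *m g q) i j) = \sum_k (fun q => f q i k * g q k j).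
  by apply/funext => q; rewrite mxE fct_sumE.
by apply: differentiable_sum => k; exact: differentiableM.
Qed.

Lemma pd_mulmx a b c (f : 'rV[R]_n -> 'M[R]_(a, b))
    (g : 'rV[R]_n -> 'M[R]_(b, c)) i p :
  differentiable f p -> differentiable g p ->
  pd i (fun q => f q *m g q) p = pd i f p *m g p + f p *m pd i g p.
Proof.
move=> df dg; apply/matrixP => k l.
have /differentiable_mx df' := df; have /differentiable_mx dg' := dg.
rewrite pd_mxE; last exact: differentiable_mulmx.
rewrite !mxE -big_split /=.
under eq_fun do rewrite mxE.
rewrite pd_sum => [|j]; last exact: differentiableM.
apply: eq_bigr => j _.
by rewrite pdM// addrC !pd_mxE// [g _ _ _ * _]mulrC.
Qed.

Lemma differentiable_trmx a b (f : 'rV[R]_n -> 'M[R]_(a, b)) p :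
  differentiable f p -> differentiable (fun q => (f q)^T) p.
Proof.
move=> /differentiable_mx df; apply/differentiable_mx => i j.
by under eq_fun do rewrite mxE.
Qed.

Lemma pd_trmx a b (f : 'rV[R]_n -> 'M[R]_(a, b)) i p :
  differentiable f p -> pd i (fun q => (f q)^T) p = (pd i f p)^T.
Proof.
move=> df; apply/matrixP => k l; rewrite pd_mxE; last exact: differentiable_trmx.
by rewrite mxE pd_mxE//; under eq_fun do rewrite mxE.
Qed.

Lemma differentiable_scale a b (f : 'rV[R]_n -> R)
    (g : 'rV[R]_n -> 'M[R]_(a, b)) p : differentiable f p ->
  differentiable g p -> differentiable (fun q => f q *: g q) p.
Proof.
move=> df /differentiable_mx dg; apply/differentiable_mx => i j.
by under eq_fun do rewrite mxE; exact: differentiableM.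
Qed.

Lemma pd_scale a b (f : 'rV[R]_n -> R) (g : 'rV[R]_n -> 'M[R]_(a, b)) i p :
  differentiable f p -> differentiable g p ->
  pd i (fun q => f q *: g q) p = pd i f p *: g p + f p *: pd i g p.
Proof.
move=> df dg; apply/matrixP => k l; have /differentiable_mx dg' := dg.
rewrite pd_mxE; last exact: differentiable_scale.
under eq_fun do rewrite mxE.
by rewrite pdM// !mxE pd_mxE// addrC [g _ _ _ * _]mulrC.
Qed.

Lemma pdC_mx a b (f : 'rV[R]_n -> 'M[R]_(a, b)) (U : set 'rV[R]_n) i j p :
  open U -> U p -> smooth_on U f -> pd i (pd j f) p = pd j (pd i f) p.
Proof.
move=> oU Up sf; apply/matrixP => k l.
have s := (smooth_mx oU _).1 sf k l.
have dpd e : differentiable (pd e f) p.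
  exact: smooth_differentiable (smooth_pd e sf) Up.
have E e : {in U, (fun q => pd e f q k l) =1 pd e (fun q => f q k l)}.
  move=> q; rewrite inE => Uq.
  exact: pd_mxE (smooth_differentiable sf Uq).
have pdE d e : pd d (pd e f) p k l = pd d (pd e (fun q => f q k l)) p.
  by apply: etrans (pd_mxE d k l (dpd e)) _; exact: pd_near oU Up (E e).
apply: etrans (pdE i j) _; apply: etrans _ (esym (pdE j i)).
exact: pdC oU Up s.
Qed.

End MatrixProductRule.

(** The data of a chart of a pseudo-Riemannian manifold. *)
Record metric_on (R : realType) n (V : set 'rV[R]_n)
    (G : 'rV[R]_n -> 'M[R]_n) : Prop := MetricOn {
  metric_on_open : open V;
  metric_on_smooth : smooth_on V G;
  metric_on_sym : forall p, V p -> (G p)^T = G p;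
  metric_on_unit : forall p, V p -> G p \in unitmx
}.

Section Christoffel.
Context {R : realType} {n : nat}.
Variables (V : set 'rV[R]_n) (G : 'rV[R]_n -> 'M[R]_n).
Hypothesis mG : metric_on V G.
Let oV := metric_on_open mG.
Let sG := metric_on_smooth mG.
Let symG := metric_on_sym mG.
Let uG := metric_on_unit mG.

(** The matrix, for the row-vector convention, of [Z |-> nabla_a Z] on constant
    vector fields [Z]. *)
Definition christoffel_mx (a : 'I_n) (p : 'rV[R]_n) : 'M[R]_n :=
  \matrix_(b, k) christoffel G p a b k.

Lemma pd_metric_sym p k a b : V p -> pd k G p a b = pd k G p b a.
Proof.
move=> Vp; have dG := smooth_differentiable sG Vp.
transitivity ((pd k G p)^T a b); last by rewrite mxE.
rewrite -pd_trmx//; congr (fun_of_matrix _ a b).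
by apply: (pd_near k oV Vp) => q; rewrite inE => /symG.
Qed.

Lemma invmx_metric_sym p a b : V p -> invmx (G p) a b = invmx (G p) b a.
Proof.
move=> Vp; transitivity ((invmx (G p))^T a b); last by rewrite mxE.
by rewrite trmx_inv symG.
Qed.

Lemma christoffelC p a b k : V p -> christoffel G p a b k = christoffel G p b a k.
Proof.
move=> Vp; have koszulC (D : 'I_n -> 'M[R]_n) l :
    (forall k c d, D k c d = D k d c) ->
    D a b l + D b a l - D l a b = D b a l + D a b l - D l b a.
  by move=> symD; rewrite [D l a b]symD [D a b l + _]addrC.
congr (_ * _); apply: eq_bigr => l _; congr (_ * _).
exact: (koszulC (fun k => pd k G p) l (fun k c d => pd_metric_sym k c d Vp)).
Qed.

Lemma christoffel_mx_lower p a b l : V p ->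
  (christoffel_mx a p *m G p) b l =
  2^-1 * (pd a G p b l + pd b G p a l - pd l G p a b).
Proof.
move=> Vp.
have -> : christoffel_mx a p = 2^-1 *:
    ((\matrix_(b, l) (pd a G p b l + pd b G p a l - pd l G p a b))
       *m invmx (G p)).
  apply/matrixP => c d; rewrite !mxE; congr (_ * _).
  by apply: eq_bigr => e _; rewrite !mxE invmx_metric_sym// mulrC.
by rewrite -scalemxAl mulmxKV ?uG// !mxE.
Qed.

(** The Levi-Civita connection is metric. *)
Lemma christoffel_mx_metric p a : V p ->
  pd a G p = christoffel_mx a p *m G p + (christoffel_mx a p *m G p)^T.
Proof.
(* The algebra is carried out for arbitrary matrices in place of the partial
   derivatives of the metric. *)
move=> Vp; have koszul (D : 'I_n -> 'M[R]_n) b l :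
    (forall k c d, D k c d = D k d c) ->
    D a b l = 2^-1 * (D a b l + D b a l - D l a b)
              + 2^-1 * (D a l b + D l a b - D b a l).
  by move=> symD; rewrite [D a l b]symD; field.
apply/matrixP => b l; rewrite [RHS]mxE [X in _ = _ + X]mxE.
apply: etrans (koszul (fun k => pd k G p) b l
  (fun k c d => pd_metric_sym k c d Vp)) _.
by apply: esym; apply: congr2; exact: christoffel_mx_lower.
Qed.

Lemma smooth_christoffel a b k : smooth_on V (fun p => christoffel G p a b k).
Proof.
have si := smooth_invmx oV uG sG.
have sd i j l : smooth_on V (fun p => pd i G p j l).
  exact: (smooth_mx oV _).1 (smooth_pd i sG) j l.
apply: smoothM => //; first exact: smooth_cst.
apply: smooth_sum => // l; apply: smoothM => //.
  exact: (smooth_mx oV _).1 si k l.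
apply: smoothD => //; first exact: smoothD.
apply: smooth_eq (smoothM oV (smooth_cst oV (-1 : R)) (sd l a b)) => // p _.
by rewrite mulN1r.
Qed.

Lemma smooth_christoffel_mx a : smooth_on V (christoffel_mx a).
Proof.
apply/(smooth_mx oV) => b k.
by apply: smooth_eq (smooth_christoffel a b k) => // p _; rewrite mxE.
Qed.

End Christoffel.
(** * The connection induced along a map *)

Section Mform.
Context {R : realType} {n : nat}.
Implicit Types (G : 'M[R]_n) (X Y Z : 'rV[R]_n).

Lemma mformDl G X Y Z : mform G (X + Y) Z = mform G X Z + mform G Y Z.
Proof. by rewrite /mform !mulmxDl mxE. Qed.

Lemma mformZl G a X Y : mform G (a *: X) Y = a * mform G X Y.
Proof. by rewrite /mform -!scalemxAl mxE. Qed.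

Lemma mformNl G X Y : mform G (- X) Y = - mform G X Y.
Proof. by rewrite -scaleN1r mformZl mulN1r. Qed.

Lemma mform_suml G (I : Type) (r : seq I) (P : pred I) (F : I -> 'rV[R]_n) Y :
  mform G (\sum_(i <- r | P i) F i) Y = \sum_(i <- r | P i) mform G (F i) Y.
Proof. by rewrite /mform !mulmx_suml summxE. Qed.

Lemma mformC G X Y : G^T = G -> mform G X Y = mform G Y X.
Proof.
move=> symG; rewrite /mform; transitivity ((X *m G *m Y^T)^T 0 0).
  by rewrite [RHS]mxE.
by rewrite !trmx_mul trmxK symG mulmxA.
Qed.

Lemma mform_gram a b G (E : 'M[R]_(a, n)) (F : 'M[R]_(b, n)) i j :
  mform G (row i E) (row j F) = (E *m G *m F^T) i j.
Proof.
rewrite /mform -row_mul tr_row mxE [RHS]mxE; apply: eq_bigr => k _.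
by rewrite !mxE.
Qed.

End Mform.

Section CurvatureAlgebra.
Context {R : realType} {n : nat}.

(** [Ci] and [Cj] stand for the connection matrices along a map with partial
    derivatives [x] and [y], and [D a b] for the derivative of [Gam b] in the
    direction [a]. The mixed second derivatives [t] of the map cancel, and the
    curvature of the induced connection is the pullback of the curvature. *)
Lemma pullback_curvature (x y t : 'I_n -> R) (Gam : 'I_n -> 'M[R]_n)
    (D : 'I_n -> 'I_n -> 'M[R]_n) (Ci Cj Dij Dji : 'M[R]_n) :
  Ci = \sum_a x a *: Gam a -> Cj = \sum_b y b *: Gam b ->
  Dij = \sum_b (t b *: Gam b + y b *: \sum_a x a *: D a b) ->
  Dji = \sum_b (t b *: Gam b + x b *: \sum_a y a *: D a b) ->
  Dij - Dji + (Cj *m Ci - Ci *m Cj) =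
  \sum_a \sum_b (x a * y b) *:
    (D a b - D b a + (Gam b *m Gam a - Gam a *m Gam b)).
Proof.
move=> -> -> -> ->; rewrite !big_split /=.
set T := \sum_b t b *: Gam b.
rewrite [T + _]addrC addrKA.
have -> : \sum_b y b *: \sum_a x a *: D a b =
    \sum_a \sum_b (x a * y b) *: D a b.
  rewrite [RHS]exchange_big; apply: eq_bigr => b _.
  by rewrite scaler_sumr; apply: eq_bigr => a _; rewrite scalerA mulrC.
have -> : \sum_b x b *: \sum_a y a *: D a b =
    \sum_a \sum_b (x a * y b) *: D b a.
  apply: eq_bigr => b _.
  by rewrite scaler_sumr; apply: eq_bigr => a _; rewrite scalerA.
have -> : (\sum_b y b *: Gam b) *m (\sum_a x a *: Gam a) =
    \sum_a \sum_b (x a * y b) *: (Gam b *m Gam a).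
  rewrite mulmx_sumr; apply: eq_bigr => a _; rewrite mulmx_suml.
  by apply: eq_bigr => b _; rewrite -scalemxAl -scalemxAr scalerA mulrC.
have -> : (\sum_a x a *: Gam a) *m (\sum_b y b *: Gam b) =
    \sum_a \sum_b (x a * y b) *: (Gam a *m Gam b).
  rewrite mulmx_suml; apply: eq_bigr => a _; rewrite mulmx_sumr.
  by apply: eq_bigr => b _; rewrite -scalemxAl -scalemxAr scalerA.
rewrite -!sumrB -big_split /=; apply: eq_bigr => a _.
rewrite -!sumrB -big_split /=; apply: eq_bigr => b _.
by rewrite scalerDr !scalerBr.
Qed.

Lemma second_derivative_difference (A B1 B2 W : 'rV[R]_n)
    (Ci Cj Dij Dji : 'M[R]_n) :
  A + (B1 *m Cj + W *m Dij + (B2 *m Ci + W *m (Cj *m Ci)))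
  - (A + (B2 *m Ci + W *m Dji + (B1 *m Cj + W *m (Ci *m Cj)))) =
  W *m (Dij - Dji + (Cj *m Ci - Ci *m Cj)).
Proof.
rewrite mulmxDr !mulmxBr.
move: (B1 *m Cj) (B2 *m Ci) (W *m Dij) (W *m Dji) (W *m (Cj *m Ci))
  (W *m (Ci *m Cj)) => b1 b2 d1 d2 e1 e2.
by apply/rowP => k; rewrite !mxE; ring.
Qed.

End CurvatureAlgebra.

Section PullbackConnection.
Context {R : realType} {m n : nat}.
Variables (U : set 'rV[R]_m) (V : set 'rV[R]_n).
Variables (f : 'rV[R]_m -> 'rV[R]_n) (K : 'rV[R]_n -> 'M[R]_n).
Hypotheses (oU : open U) (mK : metric_on V K).
Hypotheses (fUV : forall p, U p -> V (f p)) (sf : smooth_on U f).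
Let sK := metric_on_smooth mK.
Let symK := metric_on_sym mK.
Implicit Types (W X Y : 'rV[R]_m -> 'rV[R]_n) (p : 'rV[R]_m) (i j : 'I_m).

(** The pullback of the connection form of [K] by [f], evaluated on the [i]-th
    coordinate vector. *)
Definition conn_mx i p : 'M[R]_n :=
  \sum_a pd i f p 0 a *: christoffel_mx K a (f p).

Lemma covE i W p : cov K f i W p = pd i W p + W p *m conn_mx i p.
Proof.
rewrite /cov; congr (_ + _); apply/rowP => k.
rewrite mulmx_sumr summxE mxE; apply: eq_bigr => a _.
rewrite -scalemxAr !mxE mulr_sumr; apply: eq_bigr => b _.
by rewrite !mxE; ring.
Qed.

Let df p : U p -> differentiable f p.
Proof. exact: smooth_differentiable. Qed.

Let sdf i a : smooth_on U (fun p => pd i f p 0 a).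
Proof. exact: (smooth_mx oU _).1 (smooth_pd i sf) 0 a. Qed.

Lemma smooth_conn_mx i : smooth_on U (conn_mx i).
Proof.
apply: smooth_sum => // a; apply: smoothZ => //.
by have := smooth_comp oU fUV sf (smooth_christoffel_mx mK a).
Qed.

Lemma smooth_cov i W : smooth_on U W -> smooth_on U (cov K f i W).
Proof.
move=> sW.
have s : smooth_on U (fun p => pd i W p + W p *m conn_mx i p).
  apply: smoothD => //; first exact: smooth_pd.
  by apply: smooth_mulmx => //; exact: smooth_conn_mx.
by apply: smooth_eq s => // p _; rewrite covE.
Qed.

Lemma cov_near i W X p : U p -> {in U, W =1 X} -> cov K f i W p = cov K f i X p.
Proof.
by move=> Up WX; rewrite !covE (pd_near i oU Up WX) WX// inE.
Qed.

Lemma covD i W X p : U p -> smooth_on U W -> smooth_on U X ->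
  cov K f i (fun q => W q + X q) p = cov K f i W p + cov K f i X p.
Proof.
move=> Up sW sX; rewrite !covE pdD ?mulmxDl; first by rewrite addrACA.
  exact: smooth_differentiable sW Up.
exact: smooth_differentiable sX Up.
Qed.

Lemma cov_scale i (u : 'rV[R]_m -> R) W p : U p ->
  smooth_on U u -> smooth_on U W ->
  cov K f i (fun q => u q *: W q) p = pd i u p *: W p + u p *: cov K f i W p.
Proof.
move=> Up su sW; rewrite !covE pd_scale.
- by rewrite scalerDr -scalemxAl addrA.
- exact: smooth_differentiable su Up.
- exact: smooth_differentiable sW Up.
Qed.

Lemma pd_metric_along i p : U p ->
  pd i (K \o f) p = conn_mx i p *m K (f p) + (conn_mx i p *m K (f p))^T.
Proof.
move=> Up; have Vfp := fUV Up.
rewrite pd_comp; [|exact: df|exact: smooth_differentiable sK Vfp].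
rewrite mulmx_suml linear_sum -big_split /=; apply: eq_bigr => a _.
rewrite (christoffel_mx_metric mK a Vfp).
by rewrite -scalemxAl linearZ /= scalerDr.
Qed.

(** The Leibniz rule expresses that the induced connection is metric, a
    property that [pd_metric_along] pulls back from the target. *)
Lemma pd_mform i X Y p : U p -> smooth_on U X -> smooth_on U Y ->
  pd i (fun q => mform (K (f q)) (X q) (Y q)) p =
  mform (K (f p)) (cov K f i X p) (Y p) + mform (K (f p)) (X p) (cov K f i Y p).
Proof.
move=> Up sX sY.
have dX := smooth_differentiable sX Up; have dY := smooth_differentiable sY Up.
have dK : differentiable (K \o f) p.
  by apply: differentiable_comp; [exact: df|apply: (smooth_differentiable sK); exact: fUV].
have dXK : differentiable (fun q => X q *m (K \o f) q) p by exact: differentiable_mulmx.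
have dYT : differentiable (fun q => (Y q)^T) p by exact: differentiable_trmx.
rewrite /mform -(@pd_mxE _ _ _ _ (fun q => X q *m (K \o f) q *m (Y q)^T)); last first.
  exact: differentiable_mulmx.
rewrite pd_mulmx// pd_mulmx// pd_trmx// pd_metric_along// !covE /=.
set C := conn_mx i p; have symKp := symK (fUV Up).
transitivity (((pd i X p + X p *m C) *m K (f p) *m (Y p)^T +
  X p *m K (f p) *m (pd i Y p + Y p *m C)^T) 0 0); last by rewrite [LHS]mxE.
congr (fun_of_matrix _ 0 0); rewrite trmx_mul symKp !mulmxDl !mulmxDr mulmxDl linearD /= mulmxDr trmx_mul.
by rewrite !mulmxA !addrA [LHS]addrAC.
Qed.

(** This is the torsion-freeness of the connection of [K]: the second
    derivatives of [f] commute and the Christoffel symbols are symmetric. *)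
Lemma cov_pdC i j p : U p -> cov K f i (pd j f) p = cov K f j (pd i f) p.
Proof.
move=> Up; apply: (congr2 +%R (pdC_mx i j oU Up sf)).
have swap (C : 'I_n -> 'I_n -> 'I_n -> R) (v w : 'rV[R]_n) :
    (forall a b k, C a b k = C b a k) ->
    \row_k \sum_a \sum_b C a b k * v 0 a * w 0 b =
    \row_k \sum_a \sum_b C a b k * w 0 a * v 0 b.
  move=> symC; apply/rowP => k; rewrite !mxE exchange_big /=.
  apply: eq_bigr => a _; apply: eq_bigr => b _.
  by rewrite symC mulrAC.
exact: swap (fun a b k => christoffelC mK a b k (fUV Up)).
Qed.

Lemma pd_conn_mx i j p : U p ->
  pd i (conn_mx j) p = \sum_b (pd i (pd j f) p 0 b *: christoffel_mx K b (f p)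
    + pd j f p 0 b *: \sum_a pd i f p 0 a *: pd a (christoffel_mx K b) (f p)).
Proof.
move=> Up.
have dC b : differentiable (christoffel_mx K b) (f p).
  exact: smooth_differentiable (smooth_christoffel_mx mK b) (fUV Up).
have dCf b : differentiable (fun q => christoffel_mx K b (f q)) p.
  by apply: (differentiable_comp (df Up) (dC b)).
have dj b : differentiable (fun q => pd j f q 0 b) p.
  exact: smooth_differentiable (sdf j b) Up.
rewrite /conn_mx pd_sum => [|b]; last exact: differentiable_scale.
apply: eq_bigr => b _; rewrite pd_scale//; congr (_ *: _ + _ *: _).
  by rewrite pd_mxE//; apply: smooth_differentiable (smooth_pd _ sf) Up.
by have := pd_comp i (df Up) (dC b).
Qed.

(** The curvature form [d Gamma + Gamma /\ Gamma]; the products appear in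
    reverse order because connection matrices act on the right. *)
Definition curvature_mx (a b : 'I_n) (q : 'rV[R]_n) : 'M[R]_n :=
  pd a (christoffel_mx K b) q - pd b (christoffel_mx K a) q
  + (christoffel_mx K b q *m christoffel_mx K a q
     - christoffel_mx K a q *m christoffel_mx K b q).

Lemma riemannE q (X Y Z : 'rV[R]_n) : V q -> riemann K q X Y Z =
  \sum_a \sum_b (X 0 a * Y 0 b) *: (Z *m curvature_mx a b q).
Proof.
move=> Vq.
have E a b c d : riemann_coef K q a b c d = curvature_mx a b q c d.
  rewrite /riemann_coef /curvature_mx mxE; congr (_ + _).
    have dC e : differentiable (christoffel_mx K e) q.
      exact: smooth_differentiable (smooth_christoffel_mx mK e) Vq.
    have pdE e e' : pd e (christoffel_mx K e') q c d =
        pd e (fun r => christoffel K r e' c d) q.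
      rewrite pd_mxE//; congr (pd e _ q).
      by apply/funext => r; rewrite mxE.
    by rewrite [RHS]mxE [X in _ = _ + X]mxE !pdE.
  rewrite [RHS]mxE [X in _ = _ + X]mxE [X in _ = X - _]mxE [X in _ = _ - X]mxE.
  by rewrite -sumrB; apply: eq_bigr => e _; rewrite !mxE.
apply/rowP => d; rewrite mxE summxE; apply: eq_bigr => a _.
rewrite summxE; apply: eq_bigr => b _; rewrite !mxE mulr_sumr.
by apply: eq_bigr => c _; rewrite E; ring.
Qed.

(** The Ricci identity along [f]: the terms of order one and two in [W] cancel,
    since mixed derivatives of [W] agree, and only curvature remains. *)
Lemma cov_commutator i j W p : U p -> smooth_on U W ->
  cov K f i (cov K f j W) p - cov K f j (cov K f i W) p =
  riemann K (f p) (pd i f p) (pd j f p) (W p).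
Proof.
move=> Up sW; set x := pd i f p 0; set y := pd j f p 0.
have dC k : differentiable (conn_mx k) p.
  exact: smooth_differentiable (smooth_conn_mx k) Up.
have dW := smooth_differentiable sW Up.
have covcov k l : cov K f k (cov K f l W) p = pd k (pd l W) p +
    (pd k W p *m conn_mx l p + W p *m pd k (conn_mx l) p
     + (pd l W p *m conn_mx k p + W p *m (conn_mx l p *m conn_mx k p))).
  rewrite covE (@pd_near _ _ _ U _ (fun q => pd l W q + W q *m conn_mx l q))//.
    rewrite pdD; [|exact: smooth_differentiable (smooth_pd l sW) Up
                  |exact: differentiable_mulmx].
    by rewrite pd_mulmx// covE mulmxDl -!addrA mulmxA.
  by move=> q _; rewrite covE.
have swapW := pdC_mx i j oU Up sW; have swapf := pdC_mx i j oU Up sf.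
rewrite riemannE; last exact: fUV.
rewrite !covcov swapW.
apply: etrans (second_derivative_difference _ _ _ _ _ _ _ _) _.
have dCji := pd_conn_mx j i Up.
rewrite -swapf in dCji.
have dCij := pd_conn_mx i j Up.
rewrite (pullback_curvature (erefl (conn_mx i p)) (erefl (conn_mx j p)) dCij dCji).
rewrite mulmx_sumr; apply: eq_bigr => a _.
by rewrite mulmx_sumr; apply: eq_bigr => b _; rewrite -scalemxAr.
Qed.

End PullbackConnection.
(** * Isometric immersions *)

Section Traces.
Context {R : realType} {m : nat}.

Lemma sum_invmx_tr (G B : 'M[R]_m) : B^T = B ->
  \sum_i \sum_j invmx G i j * B i j = \tr (invmx G *m B).
Proof.
move=> symB; apply: eq_bigr => i _; rewrite mxE; apply: eq_bigr => j _.
by rewrite -[in RHS]symB mxE.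
Qed.

Lemma tr_invmx_conj (G B : 'M[R]_m) : G \in unitmx ->
  \tr (invmx G *m (B *m G)) = \tr B.
Proof. by move=> uG; rewrite mxtrace_mulC mulmxK. Qed.

Lemma mform_gtrace n (G : 'M[R]_m) (K : 'M[R]_n) (T : 'I_m -> 'I_m -> 'rV[R]_n)
    (Y : 'rV[R]_n) :
  mform K (gtrace G T) Y = \sum_i \sum_j invmx G i j * mform K (T i j) Y.
Proof.
rewrite mform_suml; apply: eq_bigr => i _.
by rewrite mform_suml; apply: eq_bigr => j _; rewrite mformZl.
Qed.

End Traces.

Section IsometricImmersion.
Context {R : realType} {m n : nat}.
Variables (U : set 'rV[R]_m) (V : set 'rV[R]_n).
Variables (f : 'rV[R]_m -> 'rV[R]_n) (K : 'rV[R]_n -> 'M[R]_n).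
Variable (G : 'rV[R]_m -> 'M[R]_m).
Hypotheses (mG : metric_on U G) (mK : metric_on V K).
Hypotheses (fUV : forall p, U p -> V (f p)) (sf : smooth_on U f).
Hypothesis isoG : forall p i j, U p ->
  G p i j = mform (K (f p)) (pd i f p) (pd j f p).

(** Koszul's formula: [c] is a torsion-free connection with lowered index, and
    [D] the derivative of the metric it preserves. *)
Lemma koszul_formula (c : 'I_m -> 'I_m -> 'I_m -> R) (D : 'I_m -> 'I_m -> 'I_m -> R)
    i j l : (forall i j l, c i j l = c j i l) ->
  (forall k i j, D k i j = c k i j + c k j i) ->
  2^-1 * (D i j l + D j i l - D l i j) = c i j l.
Proof.
move=> symc DE; rewrite !DE [c j i l]symc [c l i j]symc [c l j i]symc.
by field.
Qed.

Let oU := metric_on_open mG.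

(** The tangent part of the ambient connection is torsion free and preserves
    [G], hence is the Levi-Civita connection of [G]. *)
Lemma levi_civita_pullback i j l p : U p ->
  mform (K (f p)) (cov K f i (pd j f) p) (pd l f p) =
  (christoffel_mx G i p *m G p) j l.
Proof.
move=> Up; rewrite (christoffel_mx_lower mG)//; symmetry.
pose c i j l := mform (K (f p)) (cov K f i (pd j f) p) (pd l f p).
apply: (@koszul_formula c (fun k i j => pd k G p i j)).
  by move=> a b e; rewrite /c (cov_pdC oU mK fUV sf a b Up).
move=> k a b; apply: etrans (pd_mxE k a b (smooth_differentiable (metric_on_smooth mG) Up)) _.
have E : {in U, (fun q => G q a b) =1
    (fun q => mform (K (f q)) (pd a f q) (pd b f q))}.
  by move=> q; rewrite inE; exact: isoG.
apply: etrans (pd_near k oU Up E) _.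
apply: etrans (pd_mform mK fUV sf k Up (smooth_pd a sf)
  (smooth_pd b sf)) _.
by rewrite /c; congr (_ + _); apply: mformC; exact/(metric_on_sym mK)/fUV.
Qed.

(** The second covariant derivative of a vector field along [f]; its trace is
    the rough Laplacian. *)
Definition second_cov (W : 'rV[R]_m -> 'rV[R]_n) p i j : 'rV[R]_n :=
  cov K f i (cov K f j W) p - \sum_l christoffel G p i j l *: cov K f l W p.

Lemma rough_laplacianE W p : rough_laplacian G K f W p = gtrace (G p) (second_cov W p).
Proof. by []. Qed.

Lemma second_cov_scale (u : 'rV[R]_m -> R) W p i j : U p ->
  smooth_on U u -> smooth_on U W ->
  second_cov (fun q => u q *: W q) p i j =
  (pd i (pd j u) p - \sum_l christoffel G p i j l * pd l u p) *: W p
  + (pd i u p *: cov K f j W p + pd j u p *: cov K f i W p)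
  + u p *: second_cov W p i j.
Proof.
move=> Up su sW; have scW k := smooth_cov oU mK fUV sf k sW.
have spu k := smooth_pd k su.
have covE1 k : {in U, cov K f k (fun q => u q *: W q) =1
    (fun q => pd k u q *: W q + u q *: cov K f k W q)}.
  by move=> q; rewrite inE => Uq; exact: (cov_scale f K k Uq su sW).
have covE2 : cov K f i (cov K f j (fun q => u q *: W q)) p =
    (pd i (pd j u) p *: W p + pd j u p *: cov K f i W p)
    + (pd i u p *: cov K f j W p + u p *: cov K f i (cov K f j W) p).
  apply: etrans (cov_near f K oU i Up (covE1 j)) _.
  apply: etrans (covD f K i Up (smoothZ oU (spu j) sW) (smoothZ oU su (scW j))) _.
  apply: congr2; first exact: (cov_scale f K i Up (spu j) sW).
  exact: (cov_scale f K i Up su (scW j)).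
have sumE : \sum_l christoffel G p i j l *: cov K f l (fun q => u q *: W q) p =
    (\sum_l christoffel G p i j l * pd l u p) *: W p
    + u p *: \sum_l christoffel G p i j l *: cov K f l W p.
  rewrite scaler_suml scaler_sumr -big_split /=; apply: eq_bigr => l _.
  rewrite (cov_scale f K l Up su sW) scalerDr !scalerA.
  by rewrite [u p * _]mulrC.
rewrite /second_cov covE2 sumE scalerBl scalerBr.
set a := _ *: W p; set b := (\sum_l _) *: W p.
set d := pd j u p *: _; set e := pd i u p *: _.
set r := u p *: cov _ _ _ _ _; set s := u p *: _.
clearbody a b d e r s.
by apply/rowP => k; rewrite !mxE; ring.
Qed.

End IsometricImmersion.
(** * Hypersurfaces *)

Section Hypersurface.
Context {R : realType} {m n : nat}.
Variables (U : set 'rV[R]_m) (V : set 'rV[R]_n).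
Variables (f : 'rV[R]_m -> 'rV[R]_n) (K : 'rV[R]_n -> 'M[R]_n).
Variables (G A : 'rV[R]_m -> 'M[R]_m) (xi : 'rV[R]_m -> 'rV[R]_n) (eps : R).
Hypotheses (mG : metric_on U G) (mK : metric_on V K).
Hypotheses (fUV : forall p, U p -> V (f p)) (sf : smooth_on U f).
Hypothesis isoG : forall p i j, U p ->
  G p i j = mform (K (f p)) (pd i f p) (pd j f p).
Hypothesis sxi : smooth_on U xi.
Hypothesis xi_normal : forall p i, U p ->
  mform (K (f p)) (xi p) (pd i f p) = 0.
Hypothesis xi_unit : forall p, U p -> mform (K (f p)) (xi p) (xi p) = eps.
Hypothesis weingarten : forall p i, U p ->
  cov K f i xi p = - \sum_k A p i k *: pd k f p.

Let oU := metric_on_open mG.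
Let symKf p (Up : U p) := metric_on_sym mK (fUV Up).
Let symG := metric_on_sym mG.
Let uG := metric_on_unit mG.

Lemma shape_lower p i (j : 'I_m) : U p ->
  mform (K (f p)) (cov K f i xi p) (pd j f p) = - (A p *m G p) i j.
Proof.
move=> Up; rewrite weingarten// mformNl mform_suml mxE; congr (- _).
by apply: eq_bigr => k _; rewrite mformZl; congr (_ * _); symmetry; exact: isoG.
Qed.

Lemma cov_normal_normal p i : U p ->
  mform (K (f p)) (cov K f i xi p) (xi p) = 0.
Proof.
move=> Up; rewrite weingarten// mformNl mform_suml big1 ?oppr0// => k _.
by rewrite mformZl mformC ?xi_normal ?mulr0//; exact: symKf.
Qed.

Lemma smooth_mform (X Y : 'rV[R]_m -> 'rV[R]_n) :
  smooth_on U X -> smooth_on U Y ->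
  smooth_on U (fun p => mform (K (f p)) (X p) (Y p)).
Proof.
move=> sX sY; have sKf := smooth_comp oU fUV sf (metric_on_smooth mK).
have s := smooth_mulmx oU (smooth_mulmx oU sX sKf) (smooth_trmx oU sY).
exact: (smooth_mx oU _).1 s 0 0.
Qed.

(** The shape operator is recovered from the smooth pairings of [cov i xi] with
    the tangent vectors by multiplying with the inverse metric. *)
Lemma smooth_shape : smooth_on U A.
Proof.
have sB : smooth_on U
    (fun p => \matrix_(i, j) mform (K (f p)) (cov K f i xi p) (pd j f p)).
  apply/(smooth_mx oU) => i j.
  have s := smooth_mform (smooth_cov oU mK fUV sf i sxi) (smooth_pd j sf).
  by apply: smooth_eq s => // p _; rewrite mxE.
have sA := smoothN oU (smooth_mulmx oU sB
  (smooth_invmx oU uG (metric_on_smooth mG))).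
apply: smooth_eq sA => // p; rewrite inE => Up.
rewrite -mulNmx; have -> : - (\matrix_(i, j) mform (K (f p)) (cov K f i xi p)
    (pd j f p)) = A p *m G p.
  by apply/matrixP => i j; rewrite [LHS]mxE mxE shape_lower// opprK.
by rewrite mulmxK// uG.
Qed.

(** Differentiate [h (xi, pd j f) = 0]. *)
Lemma shape_second_form p i j : U p ->
  mform (K (f p)) (cov K f i (pd j f) p) (xi p) = (A p *m G p) i j.
Proof.
move=> Up.
have := pd_mform mK fUV sf i Up sxi (smooth_pd j sf).
have E : {in U, (fun q => mform (K (f q)) (xi q) (pd j f q)) =1 (fun=> 0)}.
  by move=> q; rewrite inE => Uq; exact: xi_normal.
move/(etrans (esym (pd_near i oU Up E))).
move/(etrans (esym (pd_cst (0 : R) i p))).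
rewrite shape_lower// => /eqP; rewrite eq_sym addrC subr_eq0 => /eqP <-.
by apply: mformC; exact: symKf.
Qed.

(** The shape operator is self-adjoint because the connection is torsion free.
    *)
Lemma shape_sym p : U p -> (A p *m G p)^T = A p *m G p.
Proof.
move=> Up; apply/matrixP => i j; rewrite [LHS]mxE.
apply: etrans (esym (shape_second_form j i Up)) _.
apply: etrans (shape_second_form i j Up).
exact: (congr1 (fun v => mform (K (f p)) v (xi p))
  (cov_pdC oU mK fUV sf j i Up)).
Qed.

Lemma second_form_shape p i j : U p ->
  mform (K (f p)) (second_form G K f p i j) (xi p) = (A p *m G p) i j.
Proof.
move=> Up; rewrite /second_form mformDl mformNl shape_second_form//.
rewrite mform_suml big1 ?subr0// => k _.
by rewrite mformZl mformC ?xi_normal ?mulr0//; exact: symKf.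
Qed.

Lemma tension_normal p : U p ->
  mform (K (f p)) (tension G K f p) (xi p) = \tr (A p).
Proof.
move=> Up; rewrite /tension mform_gtrace.
under eq_bigr => i _ do under eq_bigr => j _ do rewrite second_form_shape//.
by rewrite sum_invmx_tr ?tr_invmx_conj// ?uG// shape_sym.
Qed.

(** Since [cov j xi] is tangent, differentiating [h (cov j xi, xi) = 0] moves
    one derivative onto the other factor and leaves [- h (A_i, A_j)], whose
    trace is [- tr (A^2)] by self-adjointness. *)
Lemma rough_laplacian_normal p : U p ->
  mform (K (f p)) (rough_laplacian G K f xi p) (xi p) = - \tr (A p *m A p).
Proof.
move=> Up; rewrite rough_laplacianE mform_gtrace.
have E i j : mform (K (f p)) (second_cov f K G xi p i j) (xi p) =
    - (A p *m A p *m G p) i j.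
  rewrite /second_cov mformDl mformNl mform_suml big1; last first.
    by move=> l _; rewrite mformZl cov_normal_normal// mulr0.
  rewrite subr0.
  have scj := smooth_cov oU mK fUV sf j sxi.
  have := pd_mform mK fUV sf i Up scj sxi.
  have E : {in U, (fun q => mform (K (f q)) (cov K f j xi q) (xi q)) =1 (fun=> 0)}.
    by move=> q; rewrite inE => Uq; exact: cov_normal_normal.
  move/(etrans (esym (pd_near i oU Up E))).
  move/(etrans (esym (pd_cst (0 : R) i p))).
  move=> /eqP; rewrite eq_sym addr_eq0 => /eqP ->; congr (- _).
  rewrite mformC; last exact: symKf.
  rewrite (weingarten i Up) mformNl mform_suml -mulmxA [in RHS]mxE -sumrN.
  apply: eq_bigr => l _; rewrite mformZl mformC; last exact: symKf.
  rewrite shape_lower// -[in RHS]shape_sym// [in RHS]mxE; ring.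
under eq_bigr => i _ do under eq_bigr => j _ do rewrite E mulrN.
under eq_bigr => i _ do rewrite sumrN.
rewrite sumrN sum_invmx_tr ?tr_invmx_conj// ?uG//.
rewrite -mulmxA trmx_mul shape_sym// -[in RHS]shape_sym// trmx_mul.
by rewrite symG// mulmxA.
Qed.

(** The covariant derivative of [A] as an endomorphism field: the induced
    connection acts on endomorphisms by a commutator. *)
Definition nabla_shape k p :=
  pd k A p + A p *m christoffel_mx G k p - christoffel_mx G k p *m A p.

(** Differentiate [h (cov i xi, pd j f) = - (A G)_ij] in the direction [k]. *)
Lemma second_cov_tangent p k i j : U p ->
  mform (K (f p)) (second_cov f K G xi p k i) (pd j f p) =
  - (nabla_shape k p *m G p) i j.
Proof.
move=> Up; have sci := smooth_cov oU mK fUV sf i sxi.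
have dA := smooth_differentiable smooth_shape Up.
have dG := smooth_differentiable (metric_on_smooth mG) Up.
have M := pd_mform mK fUV sf k Up sci (smooth_pd j sf).
have E : {in U, (fun q => mform (K (f q)) (cov K f i xi q) (pd j f q)) =1
    (fun q => - (A q *m G q) i j)}.
  by move=> q; rewrite inE => Uq; exact: shape_lower.
have L : pd k (fun q => - (A q *m G q) i j) p =
    - (pd k A p *m G p + A p *m (christoffel_mx G k p *m G p
       + (christoffel_mx G k p *m G p)^T)) i j.
  have dAG := differentiable_mulmx dA dG.
  apply: etrans (pdN k ((differentiable_mx _ _).1 dAG i j)) _; congr (- _).
  apply: etrans (esym (pd_mxE k i j dAG)) _.
  rewrite -(christoffel_mx_metric mG k Up).
  by rewrite pd_mulmx.
have := etrans (esym L) (etrans (esym (pd_near k oU Up E)) M).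
have -> : mform (K (f p)) (cov K f i xi p) (cov K f k (pd j f) p) =
    - (A p *m (christoffel_mx G k p *m G p)^T) i j.
  rewrite weingarten// mformNl mform_suml [in RHS]mxE; congr (- _).
  apply: eq_bigr => l _; rewrite mformZl mformC; last exact: symKf.
  by rewrite (levi_civita_pullback mG mK fUV sf isoG k j l Up) [in RHS]mxE.
rewrite /second_cov mformDl mformNl mform_suml.
have -> : \sum_l mform (K (f p)) (christoffel G p k i l *: cov K f l xi p)
    (pd j f p) = - (christoffel_mx G k p *m A p *m G p) i j.
  rewrite -mulmxA mxE -sumrN; apply: eq_bigr => l _.
  by rewrite mformZl shape_lower// mulrN [christoffel_mx _ _ _ _ _]mxE.
rewrite /nabla_shape.
move: (mform _ _ _) (pd k A p) (christoffel_mx G k p) => c D C.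
rewrite mulmxDr mulmxBl mulmxDl mulmxA.
move: (D *m G p) (A p *m C *m G p) (A p *m _^T) (C *m A p *m G p) => a b d e.
rewrite !mxE => h; rewrite [c](_ : _ = - (a i j + b i j)); first by ring.
by rewrite -[LHS](addrK (- d i j)) -h; ring.
Qed.

(** Self-adjointness is preserved by covariant differentiation. *)
Lemma nabla_shape_sym k p : U p ->
  (nabla_shape k p *m G p)^T = nabla_shape k p *m G p.
Proof.
move=> Up.
have dA := smooth_differentiable smooth_shape Up.
have dG := smooth_differentiable (metric_on_smooth mG) Up.
have dAG := differentiable_mulmx dA dG.
have E : {in U, (fun q => (A q *m G q)^T) =1 (fun q => A q *m G q)}.
  by move=> q; rewrite inE => Uq; exact: shape_sym.
have D : pd k A p *m G p + A p *m (christoffel_mx G k p *m G p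
      + (christoffel_mx G k p *m G p)^T) = pd k (fun q => A q *m G q) p.
  by rewrite -(christoffel_mx_metric mG k Up) pd_mulmx.
have symD := etrans (esym (pd_trmx k dAG)) (pd_near k oU Up E).
rewrite -D in symD.
(* The derivative of the symmetric matrix [A G], corrected by a matrix plus
   its transpose. *)
have -> : nabla_shape k p *m G p = pd k A p *m G p + A p *m (christoffel_mx G k p *m G p
      + (christoffel_mx G k p *m G p)^T)
    - ((A p *m G p) *m (christoffel_mx G k p)^T
       + ((A p *m G p) *m (christoffel_mx G k p)^T)^T).
  rewrite [in X in _ - X]trmx_mul trmxK shape_sym// /nabla_shape.
  rewrite mulmxBl mulmxDl mulmxDr trmx_mul symG// !mulmxA.
  by rewrite addrA opprD addrA addrK.
rewrite linearB /= symD; congr (_ - _).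
by rewrite linearD /= trmxK addrC.
Qed.

Variable c : R.
Hypothesis curvK : forall q X Y Z, V q ->
  riemann K q X Y Z = c *: (mform (K q) Y Z *: X - mform (K q) X Z *: Y).

(** In a space of constant curvature [R (X, Y) xi] vanishes for tangent [X] and
    [Y]; this is Codazzi's equation. *)
Lemma second_covC p k i : U p ->
  second_cov f K G xi p k i = second_cov f K G xi p i k.
Proof.
move=> Up; apply: (congr2 (fun x y => x - y)); last first.
  apply: eq_bigr => l _; congr (_ *: _).
  exact: (christoffelC mG).
apply/eqP; rewrite -subr_eq0.
rewrite (cov_commutator oU mK fUV sf k i Up sxi) curvK; last exact: fUV.
have normal l : mform (K (f p)) (pd l f p) (xi p) = 0.
  by apply: etrans (mformC _ _ (symKf Up)) _; exact: xi_normal.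
by rewrite (normal i) (normal k) !scale0r subrr scaler0.
Qed.

(** By [second_covC] and [nabla_shape_sym] the tensor [h (nabla_k A_i, e_j)] is
    symmetric in its three indices, so the divergence of [A] is the gradient of
    its trace. *)
Lemma rough_laplacian_tangent p k : U p ->
  mform (K (f p)) (rough_laplacian G K f xi p) (pd k f p) =
  - pd k (fun q => \tr (A q)) p.
Proof.
move=> Up; rewrite rough_laplacianE mform_gtrace.
have T i j : mform (K (f p)) (second_cov f K G xi p i j) (pd k f p) =
    - (nabla_shape k p *m G p) i j.
  rewrite second_cov_tangent// -nabla_shape_sym// mxE -second_cov_tangent//.
  by rewrite second_covC// second_cov_tangent.
under eq_bigr => i _ do under eq_bigr => j _ do rewrite T mulrN.
under eq_bigr => i _ do rewrite sumrN.
rewrite sumrN sum_invmx_tr ?tr_invmx_conj ?nabla_shape_sym ?uG//; congr (- _).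
rewrite /nabla_shape linearB linearD /= mxtrace_mulC addrK /mxtrace.
have dA := smooth_differentiable smooth_shape Up.
have dAe := (differentiable_mx A p).1 dA.
apply: etrans (esym (pd_sum k (fun e => dAe e e))).
by apply: eq_bigr => e _; exact: pd_mxE.
Qed.

End Hypersurface.
(** * Conformal change of metric *)

Section ConformalChange.
Context {R : realType} {m : nat}.
Variables (U : set 'rV[R]_m) (G Gb : 'rV[R]_m -> 'M[R]_m) (s : 'rV[R]_m -> R).
Hypotheses (mGb : metric_on U Gb) (ss : smooth_on U s).
Hypothesis s_gt0 : forall p, U p -> 0 < s p.
Hypothesis GE : forall p, U p -> G p = s p *: Gb p.

Lemma invmx_conformal p : U p -> invmx (Gb p) = s p *: invmx (G p).
Proof.
move=> Up; rewrite GE// invmxZ ?(metric_on_unit mGb)//.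
  by rewrite scalerA divff ?scale1r// gt_eqF// s_gt0.
by rewrite unitmxZ ?(metric_on_unit mGb)// unitfE gt_eqF// s_gt0.
Qed.

(** The trace of the difference of the Christoffel symbols of two conformal
    metrics. Each of the first two terms contributes the gradient once, and the
    last one subtracts it [m] times, [m] being the trace of the metric. *)
Lemma trace_conformal_factor (B : 'M[R]_m) (v : 'I_m -> R) k : B^T = B ->
  B \in unitmx ->
  \sum_i \sum_j invmx B i j * (\sum_l invmx B k l *
    (v i * B j l + v j * B i l - v l * B i j)) =
  (2 - m%:R) * \sum_l invmx B k l * v l.
Proof.
move=> symB uB; set P := invmx B.
have PB i l : \sum_j P i j * B j l = (i == l)%:R.
  by have := congr1 (fun M : 'M[R]_m => M i l) (mulVmx uB); rewrite !mxE.
have symP i j : P i j = P j i.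
  by transitivity (P^T i j); [rewrite /P trmx_inv symB|rewrite mxE].
have symBE i j : B i j = B j i by rewrite -[in LHS]symB mxE.
transitivity (\sum_l P k l * \sum_i \sum_j P i j *
    (v i * B j l + v j * B i l - v l * B i j)).
  under eq_bigr => i _ do under eq_bigr => j _ do rewrite mulr_sumr.
  under eq_bigr => i _ do rewrite exchange_big.
  rewrite exchange_big /=; apply: eq_bigr => l _; rewrite mulr_sumr.
  apply: eq_bigr => i _; rewrite mulr_sumr.
  by apply: eq_bigr => j _; rewrite mulrCA.
rewrite mulr_sumr; apply: eq_bigr => l _.
rewrite [RHS]mulrCA; congr (_ * _).
have S1 : \sum_i \sum_j P i j * (v i * B j l) = v l.
  under eq_bigr => i _.
    under eq_bigr => j _ do rewrite mulrCA.
    rewrite -mulr_sumr PB; over.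
  rewrite (bigD1 l)//= eqxx mulr1 big1 ?addr0// => i /negPf ->.
  by rewrite mulr0.
have S2 : \sum_i \sum_j P i j * (v j * B i l) = v l.
  rewrite -[RHS]S1 exchange_big; apply: eq_bigr => i _.
  by apply: eq_bigr => j _; rewrite symP.
have S3 : \sum_i \sum_j P i j * (v l * B i j) = m%:R * v l.
  under eq_bigr => i _.
    under eq_bigr => j _ do rewrite mulrCA symBE.
    rewrite -mulr_sumr PB eqxx mulr1; over.
  by rewrite sumr_const card_ord mulr_natl.
transitivity (\sum_i \sum_j P i j * (v i * B j l)
    + \sum_i \sum_j P i j * (v j * B i l)
    - \sum_i \sum_j P i j * (v l * B i j)); last by rewrite S1 S2 S3; ring.
rewrite -big_split -sumrB /=; apply: eq_bigr => i _.
by rewrite -big_split -sumrB /=; apply: eq_bigr => j _; ring.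
Qed.

Lemma christoffel_conformal p i j k : U p ->
  christoffel G p i j k = christoffel Gb p i j k + (2 * s p)^-1 *
    \sum_l invmx (Gb p) k l * (pd i s p * Gb p j l + pd j s p * Gb p i l
                               - pd l s p * Gb p i j).
Proof.
move=> Up; have ds := smooth_differentiable ss Up.
have dGb := smooth_differentiable (metric_on_smooth mGb) Up.
have s0 : s p != 0 by rewrite gt_eqF// s_gt0.
have E : {in U, G =1 (fun q => s q *: Gb q)}.
  by move=> q; rewrite inE; exact: GE.
have D k' : pd k' G p = pd k' s p *: Gb p + s p *: pd k' Gb p.
  exact: etrans (pd_near k' (metric_on_open mGb) Up E) (pd_scale k' ds dGb).
have alg (P B : 'M[R]_m) (D' DG : 'I_m -> 'M[R]_m) (v : 'I_m -> R) (t : R) :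
    t != 0 -> (forall e, DG e = v e *: B + t *: D' e) ->
    2^-1 * \sum_l (t^-1 *: P) k l * (DG i j l + DG j i l - DG l i j) =
    2^-1 * (\sum_l P k l * (D' i j l + D' j i l - D' l i j))
    + (2 * t)^-1 *
      \sum_l P k l * (v i * B j l + v j * B i l - v l * B i j).
  move=> t0 DE; rewrite !mulr_sumr -big_split /=; apply: eq_bigr => l _.
  by rewrite !DE !mxE; field.
rewrite /christoffel.
have -> : invmx (G p) = (s p)^-1 *: invmx (Gb p).
  by rewrite invmx_conformal// scalerA mulVf// scale1r.
exact: (alg _ _ (fun e => pd e Gb p) (fun e => pd e G p) (fun e => pd e s p)).
Qed.

End ConformalChange.

Section ConformalSurface.
Context {R : realType}.
Variables (U : set 'rV[R]_2) (G Gb : 'rV[R]_2 -> 'M[R]_2) (s : 'rV[R]_2 -> R).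
Hypotheses (mGb : metric_on U Gb) (ss : smooth_on U s).
Hypothesis s_gt0 : forall p, U p -> 0 < s p.
Hypothesis GE : forall p, U p -> G p = s p *: Gb p.

Lemma gtrace_conformal (V : lmodType R) (p : 'rV[R]_2) (T : 'I_2 -> 'I_2 -> V) :
  U p -> gtrace (Gb p) T = s p *: gtrace (G p) T.
Proof.
move=> Up; rewrite /gtrace scaler_sumr; apply: eq_bigr => i _.
rewrite scaler_sumr; apply: eq_bigr => j _.
by rewrite (invmx_conformal mGb s_gt0 GE Up) mxE scalerA.
Qed.

(** In dimension two a conformal change of metric does not affect the trace of
    the Christoffel symbols, whence the conformal covariance of Laplacians. *)
Lemma gtrace_hessian_conformal (V : lmodType R) (p : 'rV[R]_2)
    (X : 'I_2 -> 'I_2 -> V) (Y : 'I_2 -> V) : U p ->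
  gtrace (Gb p) (fun i j => X i j - \sum_l christoffel Gb p i j l *: Y l) =
  s p *: gtrace (G p) (fun i j => X i j - \sum_l christoffel G p i j l *: Y l).
Proof.
move=> Up; apply: etrans _ (gtrace_conformal _ Up); rewrite /gtrace.
have split_trace (C : 'I_2 -> 'I_2 -> 'I_2 -> R) :
    \sum_i \sum_j invmx (Gb p) i j *: (X i j - \sum_l C i j l *: Y l) =
    \sum_i \sum_j invmx (Gb p) i j *: X i j
    - \sum_l (\sum_i \sum_j invmx (Gb p) i j * C i j l) *: Y l.
  under [X in _ - X]eq_bigr => l _ do rewrite scaler_suml.
  rewrite [X in _ - X]exchange_big -sumrB; apply: eq_bigr => i _.
  under [X in _ - X]eq_bigr => l _ do rewrite scaler_suml.
  rewrite [X in _ - X]exchange_big -sumrB; apply: eq_bigr => j _.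
  rewrite scalerBr scaler_sumr; congr (_ - _).
  by apply: eq_bigr => l _; rewrite scalerA.
have tracesE k : \sum_i \sum_j invmx (Gb p) i j * christoffel G p i j k =
    \sum_i \sum_j invmx (Gb p) i j * christoffel Gb p i j k.
  transitivity (\sum_i \sum_j invmx (Gb p) i j * christoffel Gb p i j k +
      (2 * s p)^-1 * \sum_i \sum_j invmx (Gb p) i j *
        \sum_l invmx (Gb p) k l * (pd i s p * Gb p j l + pd j s p * Gb p i l
                                   - pd l s p * Gb p i j)).
    rewrite mulr_sumr -big_split /=; apply: eq_bigr => i _.
    rewrite mulr_sumr -big_split /=; apply: eq_bigr => j _.
    rewrite (christoffel_conformal mGb ss s_gt0 GE i j k Up) mulrDr.
    by congr (_ + _); rewrite mulrCA.
  have F := trace_conformal_factor (fun e => pd e s p) k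
    (metric_on_sym mGb Up) (metric_on_unit mGb Up).
  apply: etrans (congr1 (fun x => _ + _ * x) F) _.
  by rewrite subrr mul0r mulr0 addr0.
apply: etrans (split_trace _) _; apply: etrans _ (esym (split_trace _)).
apply: (congr2 (fun x y => x - y) (erefl _)).
by apply: eq_bigr => k _; apply: (congr1 (fun x => x *: Y k)); rewrite tracesE.
Qed.

Variables (n : nat) (K : 'rV[R]_n -> 'M[R]_n) (f : 'rV[R]_2 -> 'rV[R]_n).

Lemma tension_conformal p : U p -> tension Gb K f p = s p *: tension G K f p.
Proof.
exact: (gtrace_hessian_conformal (fun i j => cov K f i (pd j f) p)
  (fun l => pd l f p)).
Qed.

Lemma rough_laplacian_conformal W p : U p ->
  rough_laplacian Gb K f W p = s p *: rough_laplacian G K f W p.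
Proof.
exact: (gtrace_hessian_conformal (fun i j => cov K f i (cov K f j W) p)
  (fun l => cov K f l W p)).
Qed.

End ConformalSurface.
(** * The bitension field of a conformally immersed surface *)

Section NormalFrame.
Context {R : realType} {m : nat}.

(** Tangent vectors and the unit normal have Gram matrix [diag (G, eps)], so
    they form a basis and pairing with them separates vectors. *)
Lemma normal_frame_separates (K : 'M[R]_(m + 1)) (G : 'M[R]_m)
    (J : 'M[R]_(m, m + 1)) (x v : 'rV[R]_(m + 1)) (eps : R) :
  K^T = K -> G \in unitmx -> G = J *m K *m J^T ->
  (forall i, mform K x (row i J) = 0) -> mform K x x = eps -> eps != 0 ->
  mform K v x = 0 -> (forall i, mform K v (row i J) = 0) -> v = 0.
Proof.
move=> symK uG GE xJ xx eps0 vx vJ; pose E := col_mx J x.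
have rowE (w : 'rV[R]_(m + 1)) i : (w *m K *m J^T) 0 i = mform K w (row i J).
  by rewrite -[in RHS](row_id 0 w) mform_gram.
have xJ0 : x *m K *m J^T = 0 by apply/rowP => i; rewrite rowE xJ mxE.
have Jx0 : J *m K *m x^T = 0.
  by move/(congr1 trmx): xJ0; rewrite !trmx_mul trmxK symK mulmxA trmx0.
have EKE : E *m K *m E^T = block_mx G 0 0 eps%:M.
  rewrite /E tr_col_mx mul_col_mx mul_col_row -GE xJ0 Jx0; congr block_mx.
  by rewrite [LHS]mx11_scalar; congr (_ %:M).
have uKE : K *m E^T \in unitmx.
  have : E *m (K *m E^T) \in unitmx.
    rewrite mulmxA EKE unitmxE det_ublock det_scalar expr1 unitrM -unitmxE uG.
    by rewrite unitfE.
  by rewrite unitmx_mul => /andP[].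
have vE : v *m (K *m E^T) = 0.
  rewrite mulmxA tr_col_mx mul_mx_row.
  have -> : v *m K *m J^T = 0.
    by apply/rowP => i; rewrite rowE vJ mxE.
  have -> : v *m K *m x^T = 0.
    by rewrite [LHS]mx11_scalar [X in X%:M]vx -scalemx1 scale0r.
  by rewrite row_mx0.
by rewrite -[v](mulmxK uKE) vE mul0mx.
Qed.

End NormalFrame.

Section RoughLaplacianOfScaledNormal.
Context {R : realType} {m n : nat}.
Variables (U : set 'rV[R]_m) (V : set 'rV[R]_n).
Variables (f : 'rV[R]_m -> 'rV[R]_n) (K : 'rV[R]_n -> 'M[R]_n).
Variable G : 'rV[R]_m -> 'M[R]_m.
Hypotheses (mG : metric_on U G) (mK : metric_on V K).
Hypotheses (fUV : forall p, U p -> V (f p)) (sf : smooth_on U f).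

(** The Leibniz rule for the rough Laplacian, paired with a fixed vector [Y].
    *)
Lemma mform_rough_laplacian_scale (u : 'rV[R]_m -> R) W p Y : U p ->
  smooth_on U u -> smooth_on U W ->
  mform (K (f p)) (rough_laplacian G K f (fun q => u q *: W q) p) Y =
  laplacian G u p * mform (K (f p)) (W p) Y
  + \sum_i \sum_j invmx (G p) i j *
      (pd i u p * mform (K (f p)) (cov K f j W p) Y
       + pd j u p * mform (K (f p)) (cov K f i W p) Y)
  + u p * mform (K (f p)) (rough_laplacian G K f W p) Y.
Proof.
move=> Up su sW; rewrite !rough_laplacianE !mform_gtrace /laplacian.
rewrite mulr_suml mulr_sumr -!big_split /=; apply: eq_bigr => i _.
rewrite mulr_suml mulr_sumr -!big_split /=; apply: eq_bigr => j _.
rewrite (second_cov_scale mG mK fUV sf i j Up su sW).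
move: (second_cov _ _ _ _ _ _ _) (cov K f i W p) (cov K f j W p) => S Ci Cj.
move: (pd i (pd j u) p - _) => h.
rewrite !(mformDl, mformZl); ring.
Qed.

End RoughLaplacianOfScaledNormal.
Section RoughLaplacianExtensionality.
Context {R : realType} {m n : nat}.
Variables (U : set 'rV[R]_m) (V : set 'rV[R]_n).
Variables (f : 'rV[R]_m -> 'rV[R]_n) (K : 'rV[R]_n -> 'M[R]_n).
Variable G : 'rV[R]_m -> 'M[R]_m.
Hypotheses (mG : metric_on U G) (mK : metric_on V K).
Hypotheses (fUV : forall p, U p -> V (f p)) (sf : smooth_on U f).

Lemma rough_laplacian_near W X p : U p -> {in U, W =1 X} ->
  rough_laplacian G K f W p = rough_laplacian G K f X p.
Proof.
move=> Up WX; have oU := metric_on_open mG.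
have cWX k : {in U, cov K f k W =1 cov K f k X}.
  by move=> q; rewrite inE => Uq; exact: (cov_near f K oU k Uq WX).
rewrite !rough_laplacianE; apply: eq_bigr => i _; apply: eq_bigr => j _.
congr (_ *: _); apply: (congr2 (fun x y => x - y)).
  exact: (cov_near f K oU i Up (cWX j)).
by apply: eq_bigr => l _; rewrite cWX// inE.
Qed.

Lemma rough_laplacian_cst (a : R) W p : U p -> smooth_on U W ->
  rough_laplacian G K f (fun q => a *: W q) p = a *: rough_laplacian G K f W p.
Proof.
move=> Up sW; rewrite !rough_laplacianE /gtrace scaler_sumr.
have pd0 (b : R) k : pd k (fun _ : 'rV[R]_m => b) = (fun=> 0).
  by apply/funext => q; exact: pd_cst.
apply: eq_bigr => i _; rewrite scaler_sumr; apply: eq_bigr => j _.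
rewrite (second_cov_scale mG mK fUV sf i j Up
  (smooth_cst (metric_on_open mG) a) sW) !pd0.
rewrite big1 => [|l _]; last by rewrite pd0 mulr0.
have alg (b : R) (w x y z : 'rV[R]_n) :
    b *: ((0 - 0) *: w + (0 *: x + 0 *: y) + a *: z) = a *: (b *: z).
  by rewrite subr0 !scale0r !add0r !scalerA mulrC.
exact: alg.
Qed.

End RoughLaplacianExtensionality.

Section BiharmonicSurface.
Context {R : realType}.
Variables (U : set 'rV[R]_2) (V : set 'rV[R]_3).
Variables (f : 'rV[R]_2 -> 'rV[R]_3) (K : 'rV[R]_3 -> 'M[R]_3).
Variables (G Gb A : 'rV[R]_2 -> 'M[R]_2) (xi : 'rV[R]_2 -> 'rV[R]_3).
Variables (s H : 'rV[R]_2 -> R) (eps c : R).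
Hypotheses (mG : metric_on U G) (mGb : metric_on U Gb) (mK : metric_on V K).
Hypotheses (fUV : forall p, U p -> V (f p)) (sf : smooth_on U f).
Hypothesis isoG : forall p i j, U p ->
  G p i j = mform (K (f p)) (pd i f p) (pd j f p).
Hypothesis sxi : smooth_on U xi.
Hypothesis xi_normal : forall p i, U p ->
  mform (K (f p)) (xi p) (pd i f p) = 0.
Hypothesis xi_unit : forall p, U p -> mform (K (f p)) (xi p) (xi p) = eps.
Hypothesis eps2 : eps * eps = 1.
Hypothesis weingarten : forall p i, U p ->
  cov K f i xi p = - \sum_k A p i k *: pd k f p.
Hypothesis curvK : forall q X Y Z, V q ->
  riemann K q X Y Z = c *: (mform (K q) Y Z *: X - mform (K q) X Z *: Y).
Hypotheses (ss : smooth_on U s) (s_gt0 : forall p, U p -> 0 < s p).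
Hypothesis GE : forall p, U p -> G p = s p *: Gb p.
Hypothesis H_mean : forall p, U p -> tension G K f p = (2 * H p) *: xi p.

Let oU := metric_on_open mG.
Let symKf p (Up : U p) := metric_on_sym mK (fUV Up).
Let sA := smooth_shape mG mK fUV sf isoG sxi weingarten.
Let u q := s q * H q.

(** Pair the mean curvature vector with the normal. *)
Lemma trace_shape p : U p -> \tr (A p) = (2 * eps) * H p.
Proof.
move=> Up; rewrite -(tension_normal mG mK fUV sf isoG sxi xi_normal weingarten Up).
by rewrite H_mean// mformZl xi_unit//; ring.
Qed.

(** [H] is only assumed to satisfy [H_mean]; it is smooth because [eps] is its
    own inverse and [trace_shape] then expresses it through the shape operator.
    *)
Lemma smooth_mean_curvature : smooth_on U H.
Proof.
have sT : smooth_on U (fun p => \sum_i A p i i).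
  by apply: smooth_sum => // e; exact: ((smooth_mx oU _).1 sA e e).
have sE := smoothM oU (smooth_cst oU (2^-1 * eps)) sT.
apply: smooth_eq sE => // p; rewrite inE => Up.
rewrite -/(mxtrace (A p)) trace_shape//.
have -> : 2^-1 * eps * (2 * eps * H p) = (eps * eps) * H p by field.
by rewrite eps2 mul1r.
Qed.

Lemma pd_trace_shape p k : U p ->
  pd k (fun q => \tr (A q)) p = (2 * eps) * pd k H p.
Proof.
move=> Up; have E : {in U, (fun q => \tr (A q)) =1 (fun q => (2 * eps) * H q)}.
  by move=> q; rewrite inE; exact: trace_shape.
apply: etrans (pd_near k oU Up E) _.
have dH := smooth_differentiable smooth_mean_curvature Up.
apply: etrans (pdM k (@differentiable_cst _ _ _ (2 * eps) p) dH) _.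
by rewrite pd_cst mulr0 addr0.
Qed.

(** The bitension field for [Gb] divided by [2 s], in terms of [u] and the
    induced metric [G] alone. *)
Definition half_bitension p : 'rV[R]_3 :=
  rough_laplacian G K f (fun q => u q *: xi q) p + (2 * c * u p) *: xi p.

Lemma bitension_conformal p : U p ->
  bitension Gb K f p = (2 * s p) *: half_bitension p.
Proof.
move=> Up.
have tE : {in U, tension Gb K f =1 (fun q => 2 *: (u q *: xi q))}.
  move=> q; rewrite inE => Uq.
  rewrite (tension_conformal mGb ss s_gt0 GE K f Uq) H_mean// !scalerA /u.
  by congr (_ *: _); ring.
have suxi := smoothZ oU (smoothM oU ss smooth_mean_curvature) sxi.
have roughE : rough_laplacian Gb K f (tension Gb K f) p =
    (2 * s p) *: rough_laplacian G K f (fun q => u q *: xi q) p.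
  rewrite (rough_laplacian_conformal mGb ss s_gt0 GE K f _ Up).
  rewrite (rough_laplacian_near f K mG Up tE).
  by rewrite (rough_laplacian_cst mG mK fUV sf 2 Up suxi) scalerA mulrC.
(* Since [xi] is normal, only the term [- h (X, X) xi] of the curvature tensor
   survives, and the trace of the metric is 2. *)
have curvE : gtrace (Gb p) (fun i j =>
    riemann K (f p) (pd i f p) (tension Gb K f p) (pd j f p)) =
    - ((2 * s p) *: ((2 * c * u p) *: xi p)).
  rewrite (gtrace_conformal mGb s_gt0 GE _ Up).
  have E i j : riemann K (f p) (pd i f p) (tension Gb K f p) (pd j f p) =
      (G p) i j *: (- (2 * c * u p) *: xi p).
    rewrite curvK; last exact: fUV.
    rewrite tE ?inE// !mformZl xi_normal// !mulr0 scale0r add0r.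
    by rewrite -isoG// scalerN !scalerA -scaleNr; congr (_ *: _); ring.
  have -> : gtrace (G p) (fun i j =>
      riemann K (f p) (pd i f p) (tension Gb K f p) (pd j f p)) =
      2%:R *: (- (2 * c * u p) *: xi p).
    rewrite /gtrace; under eq_bigr => i _ do under eq_bigr => j _ do
      rewrite E scalerA.
    under eq_bigr => i _ do rewrite -scaler_suml.
    rewrite -scaler_suml sum_invmx_tr ?(metric_on_sym mG)//.
    by rewrite mulVmx ?(metric_on_unit mG)// mxtrace1.
  by rewrite !scalerA -[RHS]scaleNr; congr (_ *: _); ring.
by rewrite /bitension roughE curvE opprK -scalerDr.
Qed.

Lemma half_bitension_normal p : U p ->
  mform (K (f p)) (half_bitension p) (xi p) =
  eps * (laplacian G u p + (- eps * \tr (A p *m A p) + 2 * c) * u p).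
Proof.
move=> Up; have su : smooth_on U u by exact: (smoothM oU ss smooth_mean_curvature).
rewrite mformDl mformZl.
rewrite (mform_rough_laplacian_scale mG mK fUV sf _ Up su sxi).
rewrite (rough_laplacian_normal mG mK fUV sf isoG sxi xi_normal weingarten Up).
rewrite big1 => [|i _]; last first.
  rewrite big1// => j _; have cn := cov_normal_normal mK fUV xi_normal weingarten.
  have alg (P x y a b : R) : a = 0 -> b = 0 -> P * (x * a + y * b) = 0.
    by move=> -> ->; rewrite !mulr0 addr0 mulr0.
  exact: (alg _ _ _ _ _ (cn p j Up) (cn p i Up)).
rewrite xi_unit//.
move: (laplacian G u p) (\tr _) => L T.
have -> : eps * (L + (- eps * T + 2 * c) * u p) =
  eps * L - (eps * eps) * T * u p + eps * (2 * c) * u p by ring.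
rewrite eps2; ring.
Qed.

Lemma half_bitension_tangent p k : U p ->
  mform (K (f p)) (half_bitension p) (pd k f p) =
  - 2 * ((grad G u p *m A p + (eps * u p) *: grad G H p) *m G p) 0 k.
Proof.
move=> Up; have su : smooth_on U u by exact: (smoothM oU ss smooth_mean_curvature).
rewrite mformDl mformZl xi_normal// mulr0 addr0.
rewrite (mform_rough_laplacian_scale mG mK fUV sf _ Up su sxi).
rewrite (rough_laplacian_tangent mG mK fUV sf isoG sxi xi_normal weingarten curvK k Up).
rewrite pd_trace_shape// xi_normal// mulr0 add0r.
have alg (P B : 'M[R]_2) (v : 'I_2 -> R) : P^T = P ->
    \sum_i \sum_j P i j * (v i * - B j k + v j * - B i k) =
    - 2 * ((\row_i v i) *m P *m B) 0 k.
  move=> symP; have symPE i j : P i j = P j i by rewrite -[in LHS]symP mxE.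
  have S1 : \sum_i \sum_j P i j * (v i * B j k) = ((\row_i v i) *m P *m B) 0 k.
    rewrite exchange_big mxE; apply: eq_bigr => j _.
    rewrite mxE mulr_suml; apply: eq_bigr => i _.
    by rewrite mxE; ring.
  have S2 : \sum_i \sum_j P i j * (v j * B i k) = ((\row_i v i) *m P *m B) 0 k.
    rewrite -S1 exchange_big; apply: eq_bigr => i _; apply: eq_bigr => j _.
    by rewrite symPE.
  rewrite mulNr mulr_natl mulr2n -{1}S1 -S2 -big_split -sumrN.
  apply: eq_bigr => i _; rewrite -big_split -sumrN; apply: eq_bigr => j _ /=.
  ring.
have symP : (invmx (G p))^T = invmx (G p).
  by rewrite trmx_inv (metric_on_sym mG).
have mid : \sum_i \sum_j invmx (G p) i j *
    (pd i u p * mform (K (f p)) (cov K f j xi p) (pd k f p) +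
     pd j u p * mform (K (f p)) (cov K f i xi p) (pd k f p)) =
    - 2 * ((\row_i pd i u p) *m invmx (G p) *m (A p *m G p)) 0 k.
  apply: etrans _ (alg _ _ (fun i => pd i u p) symP).
  apply: eq_bigr => i _; apply: eq_bigr => j _.
  have sl := shape_lower isoG weingarten.
  exact: (congr2 (fun a b => _ * (_ * a + _ * b)) (sl p j k Up) (sl p i k Up)).
rewrite mid.
have -> : (grad G u p *m A p + (eps * u p) *: grad G H p) *m G p =
    (\row_i pd i u p) *m invmx (G p) *m (A p *m G p)
    + (eps * u p) *: \row_i pd i H p.
  rewrite mulmxDl -scalemxAl /grad mulmxKV ?(metric_on_unit mG)//.
  by rewrite mulmxA.
rewrite [in RHS]mxE [X in _ = _ * (_ + X)]mxE [X in _ = _ * (_ + _ * X)]mxE.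
move: ((_ *m _) 0 k) (pd k H p) (u p) => X Y Z; ring.
Qed.

(** The normal and tangent components of the bitension field are nonzero
    multiples of the two left-hand sides, the second one after lowering an
    index. *)
Lemma bitension_eq0 p : U p -> bitension Gb K f p = 0 <->
  laplacian G u p + (- eps * \tr (A p *m A p) + 2 * c) * u p = 0 /\
  grad G u p *m A p + (eps * u p) *: grad G H p = 0.
Proof.
move=> Up; have uG := metric_on_unit mG Up.
have eps0 : eps != 0.
  by apply/eqP => e0; move: eps2 => /eqP; rewrite e0 mul0r eq_sym oner_eq0.
have N := half_bitension_normal Up.
have T k := half_bitension_tangent k Up.
split=> [|[e1 e2]].
  rewrite bitension_conformal// => /eqP; rewrite scaler_eq0 mulf_eq0 pnatr_eq0 /=.
  rewrite gt_eqF ?s_gt0//= => /eqP b0; rewrite b0 in N T.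
  have m0 Y : mform (K (f p)) 0 Y = 0 by rewrite /mform !mul0mx mxE.
  split.
    move: N; rewrite m0 => /esym/eqP; rewrite mulf_eq0 (negPf eps0) => /eqP.
    exact.
  set X := _ + _ in T *.
  have XG : X *m G p = 0.
    apply/rowP => k; move: (T k); rewrite m0 => /esym/eqP.
    by rewrite mulf_eq0 oppr_eq0 pnatr_eq0 /= => /eqP ->; rewrite mxE.
  by rewrite -[X](mulmxK uG) XG mul0mx.
rewrite bitension_conformal//; suff -> : half_bitension p = 0 by rewrite scaler0.
pose J : 'M[R]_(2, 2 + 1) := \matrix_k pd k f p.
have rJ k : row k J = pd k f p by rewrite rowK.
apply: (@normal_frame_separates _ 2 (K (f p)) (G p) J (xi p) _ eps) => //.
- exact: symKf.
- by apply/matrixP => i j; rewrite -mform_gram !rJ isoG.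
- by move=> i; rewrite rJ xi_normal.
- exact: xi_unit.
- by rewrite N e1 mulr0.
- by move=> i; rewrite rJ T e2 mul0mx mxE mulr0.
Qed.

End BiharmonicSurface.
(** * Passage to charts *)

Section Charts.
Context {R : realType}.

Lemma smooth_onS n (V : normedModType R) (D E : set 'rV[R]_n)
    (f : 'rV[R]_n -> V) : D `<=` E -> smooth_on E f -> smooth_on D f.
Proof.
move=> DE sf k; have := sf k; elim: k f {sf} => [//|k IH] f [df dtf].
by split=> [p /DE|i]; [exact: df|exact: (IH _ (dtf i))].
Qed.

Lemma row_jacobian m n (f : 'rV[R]_m -> 'rV[R]_n) p i : differentiable f p ->
  row i ('J f p) = pd i f p.
Proof. by move=> df; rewrite rowE /pd deriveEjacobian. Qed.

(** The inverse of a chart is only continuous at points of its image, so the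
    openness of the full image has to be used as well. *)
Lemma chart_image_open n (M : manifold R n) (x : chart M) (D : set M) :
  open D -> D `<=` cdom x -> open (cmap x @` D).
Proof.
move=> oD Dx; rewrite openE => _ [p Dp <-] /=; rewrite /interior.
have nim : nbhs (cmap x p) (cmap x @` cdom x).
  apply: open_nbhs_nbhs; split; first exact: cimage_open.
  by exists p => //; exact: Dx.
have nD : nbhs (cmap x p) (cinv x @^-1` D).
  apply: (cinv_continuous (Dx _ Dp)); rewrite cmapK; last exact: Dx.
  by apply: open_nbhs_nbhs.
apply: filterS (filterI nim nD) => q [[p' xp' <-]] /=.
by rewrite cmapK// => Dp'; exists p'.
Qed.

Lemma metric_on_chart n (M : manifold R n) (g : metric M) (x : chart M)
    (D : set M) : open D -> D `<=` cdom x ->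
  metric_on (cmap x @` D) (metric_in g x).
Proof.
move=> oD Dx; split.
- exact: chart_image_open.
- by apply: smooth_onS (mcoef_smooth g x); exact: image_subset.
- by move=> _ [p /Dx xp <-]; rewrite /metric_in /= cmapK// mcoef_sym.
- move=> _ [p /Dx xp <-]; rewrite /metric_in /= cmapK//.
  exact: mcoef_nondegenerate.
Qed.

End Charts.

Section BiharmonicInCharts.
Context {R : realType}.
Variables (c : R) (N : manifold R 3) (h : metric N).
Hypothesis h_curvature : constant_curvature h c.
Variables (M : manifold R 2) (gbar g : metric M) (phi : M -> N) (lambda : M -> R).
Hypothesis phi_conformal : conformal_immersion phi gbar h lambda g.
Variables (W : set M) (xi : chart N -> M -> 'rV[R]_3) (eps : R).
Hypothesis W_open : open W.
Hypothesis xi_normal : unit_normal phi W h xi eps.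
Variable A : chart M -> M -> 'M[R]_2.
Hypothesis A_shape : shape_operator phi W h xi A.
Variable H : M -> R.
Hypothesis H_mean : mean_curvature phi W g h xi H.

(** [bitension_eq0] applied to the coordinate expressions of all data on the
    image of the open set of points of [W] that lie in [cdom x] and are sent by
    [phi] into [cdom y]. *)
Lemma bitension_chart_eq0 x y p : W p -> cdom x p -> cdom y (phi p) ->
  let u q := lambda q ^+ 2 * H q in
  bitension (metric_in gbar x) (metric_in h y) (map_in phi x y) (cmap x p) = 0
  <->
  laplacian (metric_in g x) (u \o cinv x) (cmap x p)
    + (- eps * \tr (A x p *m A x p) + 2 * c) * u p = 0 /\
  grad (metric_in g x) (u \o cinv x) (cmap x p) *m A x p
    + (eps * u p) *: grad (metric_in g x) (H \o cinv x) (cmap x p) = 0.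
Proof.
move=> Wp xp yp u.
have [[[cphi sphi] _] slam lam0 pull GE] := phi_conformal.
have [[sxi _] eps1 xiT xiU] := xi_normal.
pose D : set M := W `&` cdom x `&` phi @^-1` cdom y.
pose U := cmap x @` D; pose V := cmap y @` cdom y.
have Dx : D `<=` cdom x by move=> q [[]].
have oD : open D.
  apply: openI; first by apply: openI => //; exact: cdom_open.
  by apply: open_comp; [move=> q _; exact: cphi|exact: cdom_open].
have mG := metric_on_chart g oD Dx; have mGb := metric_on_chart gbar oD Dx.
have mK : metric_on V (metric_in h y).
  by apply: metric_on_chart => //; exact: cdom_open.
have fUV q : U q -> V (map_in phi x y q).
  case=> r [[_ xr] yr] <-; rewrite /map_in /= cmapK//.
  by exists (phi r).
have sf : smooth_on U (map_in phi x y).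
  apply: smooth_onS (sphi x y) => _ [r [[_ xr] yr] <-].
  by exists r.
have dE i r : D r -> row i (dmap phi x y r) = pd i (map_in phi x y) (cmap x r).
  move=> Dr; apply: row_jacobian; apply: (smooth_differentiable sf).
  by exists r.
have KE r : D r -> metric_in h y (map_in phi x y (cmap x r)) = h y (phi r).
  by move=> [[_ xr] yr]; rewrite /metric_in /map_in /= cmapK// cmapK.
pose As := A x \o cinv x; pose xis := xi y \o cinv x.
pose s q := lambda (cinv x q) * lambda (cinv x q).
have isoG q i j : U q -> metric_in g x q i j =
    mform (metric_in h y (map_in phi x y q)) (pd i (map_in phi x y) q)
      (pd j (map_in phi x y) q).
  case=> r Dr <-; rewrite KE// -!dE// mform_gram.
  by case: Dr => [[_ xr] yr]; rewrite /metric_in /= cmapK// -pull.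
have xis_normal q i : U q ->
    mform (metric_in h y (map_in phi x y q)) (xis q) (pd i (map_in phi x y) q) = 0.
  case=> r Dr <-; rewrite KE// -dE// rowE /xis /=.
  by case: Dr => [[Wr xr] yr]; rewrite cmapK// xiT.
have xis_unit q : U q ->
    mform (metric_in h y (map_in phi x y q)) (xis q) (xis q) = eps.
  case=> r Dr <-; rewrite KE// /xis /=.
  by case: Dr => [[Wr xr] yr]; rewrite cmapK// xiU.
have eps2 : eps * eps = 1 by case: eps1 => ->; rewrite ?mulrNN mulr1.
have weingarten q i : U q -> cov (metric_in h y) (map_in phi x y) i xis q =
    - \sum_k As q i k *: pd k (map_in phi x y) q.
  case=> r Dr <-; have [[Wr xr] yr] := Dr.
  apply: etrans (A_shape i Wr xr yr) _; rewrite mulmx_sum_row.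
  congr (- _); apply: eq_bigr => k _; rewrite mxE -dE// /As /= cmapK//.
have curvK q X Y Z : V q -> riemann (metric_in h y) q X Y Z =
    c *: (mform (metric_in h y q) Y Z *: X - mform (metric_in h y q) X Z *: Y).
  by case=> r yr <-; rewrite h_curvature// /metric_in /= cmapK.
have oU := metric_on_open mG.
have ss : smooth_on U s.
  have sl : smooth_on U (lambda \o cinv x).
    by apply: smooth_onS (slam x); exact: image_subset.
  exact: (smoothM oU sl sl).
have s0 q : U q -> 0 < s q by move=> _; rewrite mulr_gt0.
have GsE q : U q -> metric_in g x q = s q *: metric_in gbar x q.
  by case=> r [[_ xr] _] <-; rewrite /metric_in /s /= cmapK// GE// expr2.
have HE q : U q -> tension (metric_in g x) (metric_in h y) (map_in phi x y) q
    = (2 * H (cinv x q)) *: xis q.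
  case=> r [[Wr xr] yr] <-; rewrite /xis /= cmapK// -scalerA -(H_mean Wr xr yr).
  rewrite scalerA divff ?scale1r ?pnatr_eq0//.
  by rewrite /tension /metric_in /= cmapK.
have Up : U (cmap x p) by exists p.
have := bitension_eq0 mG mGb mK fUV sf isoG (sxi x y) xis_normal xis_unit eps2
  weingarten curvK ss s0 GsE HE Up.
by rewrite /As /s /= cmapK// -!expr2.
Qed.

End BiharmonicInCharts.

Theorem theorem2p3 (R : realType) (c : R)
    (N : manifold R 3) (h : metric N)
    (h_lorentzian : lorentzian h) (h_curvature : constant_curvature h c)
    (M : manifold R 2) (gbar g : metric M) (phi : M -> N) (lambda : M -> R)
    (phi_conformal : conformal_immersion phi gbar h lambda g)
    (g_causal : riemannian g \/ lorentzian g)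
    (W : set M) (W_open : open W)
    (xi : chart N -> M -> 'rV[R]_3) (eps : R)
    (xi_normal : unit_normal phi W h xi eps)
    (A : chart M -> M -> 'M[R]_2) (A_shape : shape_operator phi W h xi A)
    (H : M -> R) (H_mean : mean_curvature phi W g h xi H) :
  let u : M -> R := fun p => lambda p ^+ 2 * H p in
  biharmonic_on phi W gbar h <->
  (forall (x : chart M) (p : M), W p -> cdom x p ->
     laplacian (metric_in g x) (u \o cinv x) (cmap x p)
       + (- eps * \tr (A x p *m A x p) + 2 * c) * u p = 0) /\
  (forall (x : chart M) (p : M), W p -> cdom x p ->
     grad (metric_in g x) (u \o cinv x) (cmap x p) *m A x p
       + (eps * u p) *: grad (metric_in g x) (H \o cinv x) (cmap x p) = 0).
Proof.
move=> u.
have E x y p (Wp : W p) (xp : cdom x p) (yp : cdom y (phi p)) :=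
  bitension_chart_eq0 h_curvature phi_conformal W_open xi_normal A_shape H_mean
    Wp xp yp.
split=> [bi|[e1 e2] x y p Wp xp yp].
  by split=> x p Wp xp; have [y yp] := cdom_cover (phi p);
    have [] := (E x y p Wp xp yp).1 (bi x y p Wp xp yp).
by apply/(E x y p Wp xp yp); split; [exact: e1|exact: e2].
Qed.
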